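(* Let $H=(V,E)$ be a hypergraph with $|V|=n$. Then $$vc(H)\le \log(\hat{\delta}(H))+1.$$ Consequently, for any $n$-vertex hypergraph $H$, $vc(H)$ can be computed in $n^{O(\log(\hat{\delta}(H)))}$ time. Particularly, if $H$ is the closed neighborhood hypergraph of an $n$-vertex graph with maximum degree $\Delta$, then $vc(H)$ can be computed in $n\,2^{O(\log^2(\Delta))}$ time.
   Context: A hypergraph $H=(V,E)$ has a finite vertex set $V$ and a set $E$ of subsets of $V$ (edges; no multiple edges). For $S\subseteq V$ and $e\in E$, the trace of $e$ on $S$ is $e\cap S$. The induced subhypergraph $H[S]$ is the hypergraph on vertex set $S$ whose edges are the distinct traces of edges of $H$ on $S$. A set $S\subseteq V$ is shattered in $H$ if every subset of $S$ is the trace on $S$ of some edge; the VC dimension $vc(H)$ is the cardinality of the largest shattered subset of $V$. The degree of a vertex in a hypergraph is the number of edges containing it. A subhypergraph of $H$ is a hypergraph obtained by deleting some edges from $H[S]$ for some $S\subseteq V$. The degeneracy $\hat{\delta}(H)$ is the largest minimum degree of any subhypergraph of $H$ (equivalently, of any induced subhypergraph of $H$). For a graph $G$ and a vertex $x$, $N(x)$ is the set of vertices adjacent to $x$ and $N[x]=N(x)\cup\{x\}$; the closed neighborhood hypergraph of $G$ has the same vertices as $G$ and its edges are the closed neighborhoods $N[x]$ of the vertices of $G$. Logarithms are to base 2. *)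

(* Defs.v *)
From mathcomp Require Import all_boot all_order all_algebra.
From mathcomp Require Import reals exp.

Set Implicit Arguments.
Unset Strict Implicit.
Unset Printing Implicit Defensive.

Import GRing.Theory Num.Theory.

Local Open Scope nat_scope.

(* A hypergraph whose vertex set is the whole finite type [V] is given by its
   edge set [H : {set {set V}}]. The subhypergraphs, which live on a subset of
   [V], are handled as pairs of a vertex set [S] and an edge set [F]. *)

(* the edge set of H[S] *)
Definition induced (V : finType) (H : {set {set V}}) (S : {set V}) :
  {set {set V}} := [set e :&: S | e in H].

Definition shattered (V : finType) (H : {set {set V}}) (S : {set V}) : bool :=
  [forall A : {set V}, (A \subset S) ==> (A \in induced H S)].

(* The empty maximum is 0; it occurs only for a hypergraph without edges, in
   which not even the empty set is shattered. *)
Definition vc (V : finType) (H : {set {set V}}) : nat :=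
  \max_(S : {set V} | shattered H S) #|S|.

Definition degree (V : finType) (F : {set {set V}}) (v : V) : nat :=
  #|[set e in F | v \in e]|.

(* The minimum over a nonempty [S]: no degree exceeds the default value #|F|. *)
Definition min_degree (V : finType) (S : {set V}) (F : {set {set V}}) : nat :=
  \big[minn/#|F|]_(v in S) degree F v.

Definition degeneracy (V : finType) (H : {set {set V}}) : nat :=
  \max_(S : {set V} | S != set0)
    \max_(F : {set {set V}} | F \subset induced H S) min_degree S F.

(* A simple graph on [V] is a symmetric irreflexive [adj : rel V]. *)
Definition neighbors (V : finType) (adj : rel V) (x : V) : {set V} :=
  [set y | adj x y].

Definition max_degree (V : finType) (adj : rel V) : nat :=
  \max_(x : V) #|neighbors adj x|.

Definition closed_neighborhood_hypergraph (V : finType) (adj : rel V) :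
  {set {set V}} := [set (x |: neighbors adj x)%SET | x : V].

(* The random access machine of Cook and Reckhow, under the uniform cost
   criterion: one step per instruction. Registers hold natural numbers and all
   start at 0, the input is read sequentially, and the machine halts when its
   program counter leaves the program. *)
Inductive instr : Type :=
| SetC of nat & nat          (* X_i <- c         *)
| Plus of nat & nat & nat      (* X_i <- X_j + X_k *)
| Minus of nat & nat & nat      (* X_i <- X_j - X_k, truncated at 0 *)
| Fetch of nat & nat           (* X_i <- X_{X_j}   *)
| Store of nat & nat          (* X_{X_i} <- X_j   *)
| Jpos of nat & nat           (* if X_i > 0 then go to l *)
| Read of nat.                (* X_i <- next input number, 0 if there is none *)

Definition program := seq instr.

Record state := State { pc : nat; reg : nat -> nat; input : seq nat }.

Definition upd (r : nat -> nat) (i v : nat) : nat -> nat :=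
  fun j => if j == i then v else r j.

Definition exec_instr (c : instr) (s : state) : state :=
  let: State p r x := s in
  match c with
  | SetC i a => State p.+1 (upd r i a) x
  | Plus i j k => State p.+1 (upd r i (r j + r k)) x
  | Minus i j k => State p.+1 (upd r i (r j - r k)) x
  | Fetch i j => State p.+1 (upd r i (r (r j))) x
  | Store i j => State p.+1 (upd r (r i) (r j)) x
  | Jpos i l => State (if 0 < r i then l else p.+1) r x
  | Read i => State p.+1 (upd r i (head 0 x)) (behead x)
  end.

Definition step (P : program) (s : state) : state :=
  if onth P (pc s) is Some c then exec_instr c s else s.

Definition init (x : seq nat) : state := State 0 (fun=> 0) x.

(* On input [x] the program halts after at most [t] steps, with [y] in X_0. *)
Definition outputs_within (P : program) (x : seq nat) (t y : nat) : Prop :=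
  let s := iter t (step P) (init x) in size P <= pc s /\ reg s 0 = y.

(* [x] describes a hypergraph on {0, ..., n-1}: n, the number of edges, and then
   each edge as its cardinality followed by its vertices. The edges may come in
   any order, without repetition, and so may the vertices of each edge. *)
Definition presents (n : nat) (x : seq nat) (H : {set {set 'I_n}}) : Prop :=
  exists es : seq (seq 'I_n),
    [/\ all uniq es,
        perm_eq [seq [set v in e]%SET | e <- es] (enum H) &
        x = n :: size es ::
              flatten [seq size e :: [seq val v | v <- e] | e <- es]].

(* Since [ln 0 = 0], [log2 0 = 0]; the degeneracy of a hypergraph is 0 exactly
   when it has no nonempty edge, and its VC dimension is then 0. *)
Definition log2 (R : realType) (x : R) : R := (ln x / ln 2)%R.

(* Main.v *)
(* A shattered set of k > 0 vertices induces its whole power set, in which every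
   vertex has degree 2^(k-1); hence the bound.

   The algorithm searches breadth first through the subsets of the edges, each
   listed in the order of its edge, and extends only the shattered ones. To test
   whether S is shattered it walks through the incidence lists of the vertices of
   S, maintaining for each edge a binary code of its trace on S and for each code
   the number of edges that have it: S is shattered when 2^|S| codes occur. With m
   edges of size at most D and degrees at most r this takes time polynomial in m,
   D^vc(H) and r, and linear in m; and vc(H) is logarithmic in the degeneracy.
   Since deleting a vertex of minimum degree merges at most that many edges,
   m <= n d + 1 for degeneracy d; in a closed neighborhood hypergraph m <= n, and
   D and r are at most Delta + 1. *)
Require Import Defs.
From mathcomp Require Import all_boot all_order all_algebra zify.

Set Implicit Arguments.
Unset Strict Implicit.
Unset Printing Implicit Defensive.

(** * While-programs and their compilation to the random access machine *)

(** The time bound that is linear in [n] shapes the algorithm. Extending a set inside one edge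
    leaves at most [D] choices, where arbitrary vertices would leave [n]; in exchange the same set
    may be listed once for each edge containing it, which costs at most a factor [m]. The program
    knows neither degeneracy nor maximum degree; they enter only the analysis, so that one program
    serves both time bounds. It is written in a small while language whose compilation costs a
    constant factor, so that jumps and registers are reasoned about only once. *)

Inductive expr : Type :=
| Var of nat
| Cst of nat
| Sum of expr & expr
| Diff of expr & expr
| Get of nat & expr.

Inductive cmd : Type :=
| Assign of nat & expr
| Put of nat & expr & expr
| Input of nat
| Seq of cmd & cmd
| While of expr & cmd.

Record wstate := WState { var : nat -> nat; arr : nat -> nat -> nat; inp : seq nat }.

Definition set_var (s : wstate) (i v : nat) : wstate :=
  WState (fun j => if j == i then v else var s j) (arr s) (inp s).

Definition set_arr (s : wstate) (a j v : nat) : wstate :=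
  WState (var s) (fun b => if b == a then upd (arr s a) j v else arr s b) (inp s).

Definition read_var (s : wstate) (i : nat) : wstate :=
  WState (fun j => if j == i then head 0 (inp s) else var s j) (arr s) (behead (inp s)).

Fixpoint eval (s : wstate) (e : expr) : nat :=
  match e with
  | Var i => var s i
  | Cst c => c
  | Sum e1 e2 => eval s e1 + eval s e2
  | Diff e1 e2 => eval s e1 - eval s e2
  | Get a e1 => arr s a (eval s e1)
  end.

(** A relation, because loops may diverge. The number counts atomic commands and loop tests;
    evaluating an expression adds nothing, since its size is fixed by the program. *)
Inductive exec : cmd -> wstate -> nat -> wstate -> Prop :=
| ExecAssign i e s : exec (Assign i e) s 1 (set_var s i (eval s e))
| ExecPut a e1 e2 s : exec (Put a e1 e2) s 1 (set_arr s a (eval s e1) (eval s e2))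
| ExecInput i s : exec (Input i) s 1 (read_var s i)
| ExecSeq c1 c2 s k1 s1 k2 s2 :
    exec c1 s k1 s1 -> exec c2 s1 k2 s2 -> exec (Seq c1 c2) s (k1 + k2) s2
| ExecWhileF e c s : eval s e = 0 -> exec (While e c) s 1 s
| ExecWhileT e c s k1 s1 k2 s2 :
    0 < eval s e -> exec c s k1 s1 -> exec (While e c) s1 k2 s2 ->
    exec (While e c) s (1 + k1 + k2) s2.

(* Registers congruent to 0 modulo 16 hold the variables, those congruent to 15
   the temporaries, and cell [j] of array [a] is register [16 j + a + 1]. *)
Notation tmp d := (d * 16 + 15).

(** Without a multiplication instruction, four doublings turn the index into its multiple by 16. *)
Definition address (d a : nat) : seq instr :=
  nseq 4 (Plus (tmp d) (tmp d) (tmp d)) ++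
  [:: SetC (tmp d.+1) a.+1; Plus (tmp d) (tmp d) (tmp d.+1)].

(** The machine cannot copy a register directly; a copy adds 0. *)
Fixpoint cexpr (d : nat) (e : expr) : seq instr :=
  match e with
  | Var i => [:: SetC (tmp d) 0; Plus (tmp d) (i * 16) (tmp d)]
  | Cst c => [:: SetC (tmp d) c]
  | Sum e1 e2 => cexpr d e1 ++ cexpr d.+1 e2 ++ [:: Plus (tmp d) (tmp d) (tmp d.+1)]
  | Diff e1 e2 => cexpr d e1 ++ cexpr d.+1 e2 ++ [:: Minus (tmp d) (tmp d) (tmp d.+1)]
  | Get a e1 => cexpr d e1 ++ address d a ++ [:: Fetch (tmp d) (tmp d)]
  end.

(** Jump targets are absolute, hence the offset [o]. An unconditional jump tests a temporary just
    set to 1. *)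
Fixpoint ccmd (o : nat) (c : cmd) : seq instr :=
  match c with
  | Assign i e =>
      cexpr 0 e ++ [:: SetC (tmp 1) 0; Plus (i * 16) (tmp 0) (tmp 1)]
  | Put a e1 e2 =>
      cexpr 0 e1 ++ address 0 a ++ cexpr 1 e2 ++ [:: Store (tmp 0) (tmp 1)]
  | Input i => [:: Read (i * 16)]
  | Seq c1 c2 => ccmd o c1 ++ ccmd (o + size (ccmd o c1)) c2
  | While e c1 =>
      let b := o + size (cexpr 0 e) + 3 in
      cexpr 0 e ++
      [:: Jpos (tmp 0) b; SetC (tmp 0) 1; Jpos (tmp 0) (b + size (ccmd b c1) + 2)] ++
      ccmd b c1 ++ [:: SetC (tmp 0) 1; Jpos (tmp 0) o]
  end.

Fixpoint wf_expr (e : expr) : bool :=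
  match e with
  | Sum e1 e2 | Diff e1 e2 => wf_expr e1 && wf_expr e2
  | Get a e1 => (a < 14) && wf_expr e1
  | _ => true
  end.

Fixpoint wf_cmd (c : cmd) : bool :=
  match c with
  | Assign _ e => wf_expr e
  | Put a e1 e2 => [&& a < 14, wf_expr e1 & wf_expr e2]
  | Input _ => true
  | Seq c1 c2 => wf_cmd c1 && wf_cmd c2
  | While e c1 => wf_expr e && wf_cmd c1
  end.

(** * Correctness of the compilation *)

Definition represents (r : nat -> nat) (s : wstate) : Prop :=
  (forall i, r (i * 16) = var s i) /\
  (forall a j, a < 14 -> r (j * 16 + a.+1) = arr s a j).

Definition code_at (P : program) (o : nat) (cs : seq instr) : Prop :=
  exists pre post, P = pre ++ cs ++ post /\ size pre = o.

Lemma code_at_cat P o c1 c2 :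
  code_at P o (c1 ++ c2) -> code_at P o c1 /\ code_at P (o + size c1) c2.
Proof.
move=> [pre [post [-> <-]]]; split.
  by exists pre, (c2 ++ post); rewrite -!catA.
by exists (pre ++ c1), post; rewrite size_cat -!catA.
Qed.

Lemma code_at_cons P o c cs :
  code_at P o (c :: cs) -> code_at P o [:: c] /\ code_at P o.+1 cs.
Proof. by rewrite -cat1s => /code_at_cat; rewrite addn1. Qed.

Lemma code_at_step P o c r x :
  code_at P o [:: c] -> step P (State o r x) = exec_instr c (State o r x).
Proof.
move=> [pre [post [-> <-]]]; rewrite /step /= onth_cat ltnn subnn.
by [].
Qed.

Definition straight (c : instr) : bool := if c is Jpos _ _ then false else true.

Definition run (cs : seq instr) (s : state) : state :=
  foldl (fun s c => exec_instr c s) s cs.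

Lemma run_cat cs1 cs2 s : run (cs1 ++ cs2) s = run cs2 (run cs1 s).
Proof. exact: foldl_cat. Qed.

Lemma iter_run P cs s :
  all straight cs -> code_at P (pc s) cs -> iter (size cs) (step P) s = run cs s.
Proof.
elim: cs s => // c cs IH s /= /andP[sc scs].
rewrite -cat1s => /code_at_cat[a1 a2]; rewrite -iterS iterSr.
case: s a1 a2 => o r x a1 a2; rewrite (code_at_step _ _ a1) IH //.
by rewrite addn1 in a2; case: c sc {a1}.
Qed.

Lemma straight_address d a : all straight (address d a).
Proof. by []. Qed.

Lemma straight_cexpr d e : all straight (cexpr d e).
Proof.
by elim: e d => //= [e1 I1 e2 I2|e1 I1 e2 I2|a e1 I1] d; rewrite !all_cat ?I1 ?I2.
Qed.

Arguments upd : simpl never.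

Lemma upd_same r i v : upd r i v i = v.
Proof. by rewrite /upd eqxx. Qed.

Lemma upd_other r i v j : j <> i -> upd r i v j = r j.
Proof. by rewrite /upd => /eqP/negbTE->. Qed.

(** The temporaries form a stack: code for depth [d] may overwrite only those of depth [d] or more,
    so an operand computed at a smaller depth survives. *)
Definition agree_below (d : nat) (r r' : nat -> nat) : Prop :=
  forall y, (forall d', d <= d' -> y <> tmp d') -> r' y = r y.

Lemma represents_agree d r r' s :
  represents r s -> agree_below d r r' -> represents r' s.
Proof. by move=> [hv ha] h; split=> *; rewrite h ?hv ?ha // => *; lia. Qed.

Lemma run_address d a o r x :
  exists2 r', run (address d a) (State o r x) = State (o + size (address d a)) r' x &
    r' (tmp d) = r (tmp d) * 16 + a.+1 /\ agree_below d r r'.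
Proof.
eexists; first by rewrite [o + size _]addnC.
split=> [|y hy]; last by rewrite !upd_other //; apply: hy; lia.
by rewrite !upd_same upd_other; [rewrite !upd_same|]; lia.
Qed.

Opaque address.

Lemma run_cexpr s d e o r x :
  wf_expr e -> represents r s ->
  exists2 r', run (cexpr d e) (State o r x) = State (o + size (cexpr d e)) r' x &
    r' (tmp d) = eval s e /\ agree_below d r r'.
Proof.
elim: e d o r => [i|c|e1 I1 e2 I2|e1 I1 e2 I2|a e1 I1] d o r /=.
- move=> _ [hv _]; eexists; first by rewrite [o + 2]addnC.
  split=> [|y hy]; last by rewrite !upd_other //; apply: hy.
  by rewrite !upd_same upd_other ?hv ?addn0 //; lia.
- move=> _ _; eexists; first by rewrite [o + 1]addnC.
  by split=> [|y hy]; rewrite ?upd_same // upd_other //; apply: hy.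
- case/andP=> w1 w2 R; rewrite !run_cat.
  have [r1 -> [v1 h1]] := I1 d o r w1 R.
  have [r2 -> [v2 h2]] := I2 d.+1 (o + size (cexpr d e1)) r1 w2 (represents_agree R h1).
  eexists; first by rewrite /= !size_cat /= !addnA addn1.
  split=> [|y hy].
    by rewrite upd_same v2 h2 ?v1 // => *; lia.
  rewrite upd_other ?h2 ?h1 //; by [apply: hy | move=> d' /ltnW; apply: hy].
- case/andP=> w1 w2 R; rewrite !run_cat.
  have [r1 -> [v1 h1]] := I1 d o r w1 R.
  have [r2 -> [v2 h2]] := I2 d.+1 (o + size (cexpr d e1)) r1 w2 (represents_agree R h1).
  eexists; first by rewrite /= !size_cat /= !addnA addn1.
  split=> [|y hy].
    by rewrite upd_same v2 h2 ?v1 // => *; lia.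
  rewrite upd_other ?h2 ?h1 //; by [apply: hy | move=> d' /ltnW; apply: hy].
- case/andP=> la w1 R; rewrite 2!run_cat.
  have [r1 -> [v1 h1]] := I1 d o r w1 R.
  have [r2 -> [v2 h2]] := run_address d a (o + size (cexpr d e1)) r1 x.
  eexists; first by rewrite /= !size_cat /= !addnA addn1.
  split=> [|y hy].
    by rewrite upd_same v2 v1 h2 ?h1 ?R.2 // => *; lia.
  rewrite upd_other ?h2 ?h1 //; exact: hy.
Qed.

(* Every atomic command runs through its own code at most once, hence the factor. *)
Lemma exec_compiled P c s k s' :
  exec c s k s' -> wf_cmd c -> forall o r,
  code_at P o (ccmd o c) -> represents r s ->
  exists t r',
    [/\ iter t (step P) (State o r (inp s)) =
          State (o + size (ccmd o c)) r' (inp s'),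
        represents r' s' & t <= size (ccmd o c) * k].
Proof.
elim=> {c s k s'}.
- move=> i e s /= we o r A R; have [r1 E1 [v1 h1]] := run_cexpr 0 o (inp s) we R.
  exists (size (ccmd o (Assign i e))); eexists; split; first rewrite iter_run //.
  + by rewrite run_cat E1 /= size_cat /= addnA addn2.
  + by rewrite all_cat straight_cexpr.
  + have [hv ha] := represents_agree R h1; split=> [i'|a j la] /=.
      have [->|ne] := eqVneq i' i; first by rewrite !upd_same upd_other // v1 addn0.
      rewrite upd_other; last by move/eqP: ne; lia.
      by rewrite upd_other ?hv //; lia.
    rewrite upd_other; last by lia.
    by rewrite upd_other ?ha //; lia.
  + by rewrite muln1.
- move=> a e1 e2 s /= /and3P[la w1 w2] o r A R.
  have [r1 E1 [v1 h1]] := run_cexpr 0 o (inp s) w1 R.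
  have [r2 E2 [v2 h2]] := run_address 0 a (o + size (cexpr 0 e1)) r1 (inp s).
  have R2 := represents_agree (represents_agree R h1) h2.
  have [r3 E3 [v3 h3]] :=
    run_cexpr 1 (o + size (cexpr 0 e1) + size (address 0 a)) (inp s) w2 R2.
  have R3 := represents_agree R2 h3.
  exists (size (ccmd o (Put a e1 e2))); eexists; split; first rewrite iter_run //.
  + by rewrite 3!run_cat E1 E2 E3 /= !size_cat /= !addnA addn1.
  + by rewrite all_cat straight_cexpr all_cat straight_address all_cat straight_cexpr.
  + have -> : r3 (tmp 0) = eval s e1 * 16 + a.+1.
      by rewrite h3 ?v2 ?v1 // => *; lia.
    rewrite v3; split=> [i|b j lb] /=; first by rewrite upd_other ?R3.1 //; lia.
    have [->|ne] := eqVneq b a; last first.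
      by rewrite upd_other ?R3.2 //; move/eqP: ne; lia.
    have [->|ne] := eqVneq j (eval s e1); first by rewrite !upd_same.
    by move/eqP: ne => ne; rewrite !upd_other ?R3.2 //; lia.
  + by rewrite muln1.
- move=> i s /= _ o r A [hv ha]; exists 1, (upd r (i * 16) (head 0 (inp s))); split=> //.
    by rewrite /= (code_at_step _ _ A) /= addn1.
  split=> [i'|a j la] /=; last by rewrite upd_other ?ha //; lia.
  have [->|/eqP ne] := eqVneq i' i; first by rewrite upd_same.
  by rewrite upd_other ?hv //; lia.
- move=> c1 c2 s k1 s1 k2 s2 _ I1 _ I2 /= /andP[w1 w2] o r /code_at_cat[A1 A2] R.
  have [t1 [r1 [E1 R1 b1]]] := I1 w1 o r A1 R.
  have [t2 [r2 [E2 R2 b2]]] := I2 w2 (o + size (ccmd o c1)) r1 A2 R1.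
  exists (t2 + t1), r2; split=> //; first by rewrite iterD E1 E2 size_cat addnA.
  rewrite size_cat mulnDl addnC !mulnDr.
  by rewrite leq_add // (leq_trans b1, leq_trans b2) // (leq_addr, leq_addl).
- move=> e c s E0 /= /andP[we wc] o r A R.
  set b := o + size (cexpr 0 e) + 3 in A *.
  have [r1 E1 [v1 h1]] := run_cexpr 0 o (inp s) we R.
  case/code_at_cat: A => A1 /code_at_cons[A2 /code_at_cons[A3 /code_at_cons[A4 _]]].
  exists (3 + size (cexpr 0 e)), (upd r1 15 1); split.
  + rewrite iterD iter_run ?straight_cexpr // E1 /= (code_at_step _ _ A2) /= v1 E0 /=.
    rewrite (code_at_step _ _ A3) /= (code_at_step _ _ A4) /= ?upd_same /=.
    congr State; rewrite /b !size_cat /= size_cat /=; lia.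
  + apply: (@represents_agree 0 r1); first exact: represents_agree R h1.
    by move=> y hy; rewrite upd_other //; apply: (hy 0).
  + rewrite !size_cat /= size_cat /=; lia.
- move=> e c s k1 s1 k2 s2 E0 _ I1 _ I2 W o r A R; move: (A) (W) => /= A' /andP[we wc].
  move: A'; set b := o + size (cexpr 0 e) + 3 => A'.
  have [r1 E1 [v1 h1]] := run_cexpr 0 o (inp s) we R.
  case/code_at_cat: A' => A1 /code_at_cons[A2 /code_at_cons[_ /code_at_cons[_]]].
  rewrite -addn3 -/b => /code_at_cat[A3 /code_at_cons[A4 A5]].
  have [t1 [r2 [E2 R2 b1]]] := I1 wc b r1 A3 (represents_agree R h1).
  have R3 : represents (upd r2 15 1) s1.
    by apply: (represents_agree R2 (d := 0)) => y hy; rewrite upd_other //; apply: (hy 0).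
  have [t2 [r3 [E3 R4 b2]]] := I2 W o (upd r2 15 1) A R3.
  exists (t2 + (2 + (t1 + (1 + size (cexpr 0 e))))), r3; split=> //.
    rewrite iterD iterD iterD iterD iter_run ?straight_cexpr // E1 /=.
    rewrite (code_at_step _ _ A2) /= v1 E0 E2 (code_at_step _ _ A4) /=.
    by rewrite (code_at_step _ _ A5) /= ?upd_same /= -E3.
  move: b1 b2; rewrite /= -/b !size_cat /= !size_cat /=.
  move: (size (ccmd b c)) (size (cexpr 0 e)) => x y; nia.
Qed.

(** * Shattered sets, degrees and degeneracy *)

Lemma induced_sub (V : finType) (H : {set {set V}}) (S : {set V}) :
  induced H S \subset powerset S.
Proof. by apply/subsetP=> _ /imsetP[e _ ->]; rewrite powersetE subsetIr. Qed.

Lemma shattered_induced (V : finType) (H : {set {set V}}) (S : {set V}) :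
  shattered H S -> induced H S = powerset S.
Proof.
move=> /forallP sh; apply/eqP; rewrite eqEsubset induced_sub.
by apply/subsetP=> A; rewrite powersetE; apply/implyP.
Qed.

(** Adding [v] embeds the subsets of [S :\ v] into the subsets of [S] through [v]. *)
Lemma degree_powerset (V : finType) (S : {set V}) v :
  v \in S -> 2 ^ #|S|.-1 <= degree (powerset S) v.
Proof.
move=> vS; have -> : #|S|.-1 = #|S :\ v| by rewrite (cardsD1 v S) vS.
rewrite -card_powerset -(@card_in_imset _ _ (fun A => v |: A)); last first.
  move=> A B; rewrite !powersetE !subsetD1 => /andP[_ vA] /andP[_ vB] /setP eAB.
  apply/setP=> x; move: (eAB x); rewrite !inE; case: eqP => // -> _.
  by rewrite (negbTE vA) (negbTE vB).
apply/subset_leq_card/subsetP=> e /imsetP[A]; rewrite powersetE subsetD1.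
by case/andP=> AS _ ->; rewrite !inE eqxx subUset sub1set vS AS.
Qed.

Lemma degree_induced (V : finType) (H : {set {set V}}) (S : {set V}) v :
  v \in S -> degree (induced H S) v <= degree H v.
Proof.
move=> vS; apply: leq_trans (leq_imset_card (fun e => e :&: S) _).
apply/subset_leq_card/subsetP=> A; rewrite inE => /andP[/imsetP[e eH ->]].
by rewrite inE vS andbT => ve; apply/imset_f; rewrite inE eH.
Qed.

Lemma shattered_degree (V : finType) (H : {set {set V}}) (S : {set V}) v :
  shattered H S -> v \in S -> 2 ^ #|S|.-1 <= degree H v.
Proof.
move=> sh vS; apply: leq_trans (degree_induced H vS).
by rewrite (shattered_induced sh) degree_powerset.
Qed.

Lemma shattered_degeneracy (V : finType) (H : {set {set V}}) (S : {set V}) :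
  shattered H S -> S != set0 -> 2 ^ #|S|.-1 <= degeneracy H.
Proof.
move=> sh S0; apply: (bigmax_sup S) => //.
rewrite (shattered_induced sh); apply: (bigmax_sup (powerset S)) => //.
rewrite /min_degree; elim/big_ind: _ => [|x y|v vS]; last exact: degree_powerset.
  (* The default value of the minimum, here [2 ^ #|S|], must respect the bound too. *)
  by rewrite card_powerset leq_exp2l // leq_pred.
by rewrite leq_min => -> ->.
Qed.

Lemma vc_attained (V : finType) (H : {set {set V}}) :
  0 < vc H -> exists2 S : {set V}, shattered H S & #|S| = vc H.
Proof.
rewrite /vc => v0; have [S sh|no] := pickP (shattered H).
  have [S' sh' ->] := @eq_bigmax_cond _ [pred S | shattered H S]
    (fun S : {set V} => #|S|) (introT card_gt0P (ex_intro _ S sh)).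
  by exists S'.
by rewrite big_pred0 in v0.
Qed.

Lemma leq_vc (V : finType) (H : {set {set V}}) (S : {set V}) :
  shattered H S -> #|S| <= vc H.
Proof. by move=> sh; apply: leq_bigmax_cond. Qed.

Lemma vc_degeneracy (V : finType) (H : {set {set V}}) :
  0 < vc H -> 2 ^ (vc H).-1 <= degeneracy H.
Proof.
move=> v0; have [S sh cS] := vc_attained v0.
by rewrite -cS shattered_degeneracy // -card_gt0 cS.
Qed.

Lemma vc_degree (V : finType) (H : {set {set V}}) r :
  (forall v, degree H v <= r) -> 0 < vc H -> 2 ^ (vc H).-1 <= r.
Proof.
move=> dr v0; have [S sh cS] := vc_attained v0.
have /card_gt0P[v vS] : 0 < #|S| by rewrite cS.
by rewrite -cS (leq_trans (shattered_degree sh vS)).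
Qed.

Lemma shattered_sub (V : finType) (H : {set {set V}}) (S T : {set V}) :
  shattered H S -> T \subset S -> shattered H T.
Proof.
move=> /forallP sh TS; apply/forallP=> A; apply/implyP=> AT.
have /imsetP[e eH eA] := implyP (sh A) (subset_trans AT TS).
by apply/imsetP; exists e => //; rewrite -(setIidPr TS) setIA -eA; apply/esym/setIidPl.
Qed.

(** * The number of edges in terms of the degeneracy *)

Lemma exists_min_degree (V : finType) (S : {set V}) (F : {set {set V}}) :
  S != set0 -> exists2 v, v \in S & degree F v <= min_degree S F.
Proof.
move=> /set0Pn[x xS]; have [v vS vmin] := arg_minnP (degree F) xS.
exists v => //; rewrite /min_degree.
elim/big_ind: _ => [|y z|w]; last exact: vmin.
  by apply/subset_leq_card/subsetP=> e; rewrite inE => /andP[].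
by rewrite leq_min => -> ->.
Qed.

(* Deleting a vertex of minimum degree merges at most that many edges. *)
Lemma card_induced (V : finType) (H : {set {set V}}) (S : {set V}) :
  #|induced H S| <= #|S| * degeneracy H + 1.
Proof.
have [k] := ubnP #|S|; elim: k S => // k IH S; rewrite ltnS => cS.
have [->|S0] := eqVneq S set0.
  rewrite cards0 mul0n add0n -(cards1 (set0 : {set V})) subset_leq_card //.
  by apply/subsetP=> _ /imsetP[e _ ->]; rewrite setI0 inE.
have [v vS dv] := exists_min_degree (induced H S) S0.
have dv' : degree (induced H S) v <= degeneracy H.
  rewrite (leq_trans dv) //; apply: (bigmax_sup S) => //.
  exact: (bigmax_sup (induced H S)).
have c1 : #|S| = #|S :\ v|.+1 by rewrite (cardsD1 v S) vS.
have h := IH (S :\ v) ltac:(lia).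
(* A trace on [S] that avoids [v] is also a trace on [S :\ v]; the other traces are counted by the
   degree of [v]. *)
have : #|[set e : {set V} in induced H S | v \notin e]| <= #|induced H (S :\ v)|.
  apply/subset_leq_card/subsetP=> A; rewrite inE => /andP[/imsetP[e eH ->]].
  rewrite inE vS andbT => ve; apply/imsetP; exists e => //.
  apply/setP=> x; rewrite !inE; case: eqP => //= ->; by rewrite (negbTE ve).
have -> : #|induced H S| =
    degree (induced H S) v + #|[set e : {set V} in induced H S | v \notin e]|.
  rewrite -[LHS](cardsID [set e : {set V} | v \in e]) /degree; congr (_ + _).
    by apply: eq_card => A; rewrite !inE andbC.
  by apply: eq_card => A; rewrite !inE andbC.
rewrite c1 mulSn; lia.
Qed.

Lemma card_edges (V : finType) (H : {set {set V}}) :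
  #|H| <= #|V| * degeneracy H + 1.
Proof.
rewrite -cardsT; apply: leq_trans (card_induced H setT).
rewrite subset_leq_card //; apply/subsetP=> e eH.
by apply/imsetP; exists e; rewrite ?setIT.
Qed.

(** * Trace codes *)

(* The trace of [A] on [S] as a binary number, one digit per entry of [S]. *)
Definition trace_code (V : finType) (S : seq V) (A : {set V}) : nat :=
  foldr (fun v c => (v \in A) + c.*2) 0 S.

Lemma trace_code_lt (V : finType) (S : seq V) (A : {set V}) :
  trace_code S A < 2 ^ size S.
Proof. by elim: S => //= v S; rewrite expnS; case: (v \in A); lia. Qed.

Lemma trace_code_rcons (V : finType) (S : seq V) v (A : {set V}) :
  trace_code (rcons S v) A = trace_code S A + 2 ^ size S * (v \in A).
Proof. by elim: S => /= [|u S ->]; rewrite ?expnS; lia. Qed.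

Lemma eq_trace_code (V : finType) (S : seq V) (A B : {set V}) :
  trace_code S A = trace_code S B <-> {in S, A =i B}.
Proof.
elim: S => [|v S IH] /=; first by split.
split=> [e x|e].
  have [ev ec] : (v \in A) = (v \in B) /\ trace_code S A = trace_code S B.
    by move: e; case: (v \in A) (v \in B) => -[]; lia.
  by rewrite inE => /orP[/eqP->|]; last exact: IH.1.
by rewrite e ?mem_head // (IH.2 _) // => x xS; rewrite e // inE xS orbT.
Qed.

(** The binary digits of [c] decide which entries of [S] to take; without repetitions these
    decisions are independent. *)
Lemma trace_code_surj (V : finType) (S : seq V) c :
  uniq S -> c < 2 ^ size S ->
  exists2 A : {set V}, A \subset S & trace_code S A = c.
Proof.
elim: S c => [|v S IH] c /=.
  rewrite expn0 ltnS leqn0 => _ /eqP->; exists set0 => //.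
  by apply/subsetP=> x; rewrite inE.
case/andP=> vS uS; rewrite expnS => lc.
have [A AS Ac] := IH c./2 uS ltac:(lia).
have vA : v \notin A by apply: contra vS; apply: (subsetP AS).
pose B := if odd c then v |: A else A.
have BA : {in S, B =i A}.
  move=> x xS; rewrite /B; case: odd => //; rewrite !inE; case: eqP => // xv.
  by rewrite -xv xS in vS.
exists B.
  apply/subsetP=> x; rewrite /B inE; case: odd => [|/(subsetP AS)->]; last by rewrite orbT.
  by rewrite !inE => /orP[->|/(subsetP AS)->] //; rewrite orbT.
rewrite (eq_trace_code S B A).2 // Ac -[RHS]odd_double_half; congr (_ + _).
by rewrite /B; case: odd; rewrite ?inE ?eqxx // (negbTE vA).
Qed.

(** * Counting the codes that occur *)

Definition count_code (T : nat -> nat) (m c : nat) : nat := \sum_(f < m) (T f == c).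

Definition distinct_codes (T : nat -> nat) (m N : nat) : nat :=
  \sum_(c < N) (0 < count_code T m c).

(** The index [f] moves from the count of its old code to that of its new one; sums on both sides
    avoid truncated subtraction. *)
Lemma count_code_upd (T : nat -> nat) m f w c :
  f < m -> 0 < w ->
  count_code (upd T f (T f + w)) m c + (T f == c) =
    count_code T m c + (T f + w == c).
Proof.
move=> fm w0; rewrite /count_code (bigD1 (Ordinal fm)) // [X in _ = X + _](bigD1 (Ordinal fm)) //=.
rewrite upd_same.
rewrite (eq_bigr (fun i : 'I_m => (T i == c) : nat)); first by lia.
by move=> i ne; rewrite upd_other // => e; case/eqP: ne; apply: val_inj.
Qed.

Lemma count_code_gt0 (T : nat -> nat) m f : f < m -> 0 < count_code T m (T f).
Proof. by move=> fm; rewrite /count_code (bigD1 (Ordinal fm)) //= eqxx. Qed.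

(** The truncated expressions are those by which [visit_edge] updates [vD]: the first is 1 exactly
    when [f] was the only index with its old code, the second exactly when the new code did not
    occur. *)
Lemma distinct_codes_upd (T : nat -> nat) m N f w :
  f < m -> 0 < w -> T f + w < N ->
  distinct_codes (upd T f (T f + w)) m N =
    distinct_codes T m N - (1 - (count_code T m (T f) - 1)) +
    (1 - count_code T m (T f + w)).
Proof.
move=> fm w0 lN; have lf : T f < N by lia.
have ne : Ordinal lN != Ordinal lf by rewrite -val_eqE /=; lia.
rewrite /distinct_codes (bigD1 (Ordinal lf)) // (bigD1 (Ordinal lN)) //=.
rewrite [X in _ = X - _ + _](bigD1 (Ordinal lf)) // (bigD1 (Ordinal lN) (P := [pred i | i != Ordinal lf])) //=.
have c0 := count_code_gt0 T fm.
have := count_code_upd T (T f) fm w0; have := count_code_upd T (T f + w) fm w0.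
rewrite !eqxx; have -> : (T f + w == T f) = false by lia.
have -> : (T f == T f + w) = false by lia.
rewrite [X in _ -> _ -> _ + (_ + X) = _](eq_bigr
  (fun c : 'I_N => (0 < count_code T m c) : nat)).
  set X := (X in _ -> _ -> _ + (_ + X) = _); rewrite -/X; move: X c0 => X.
  move: (count_code _ m _) (count_code _ m _) (count_code T m _) (count_code T m _).
  by move=> [|a] [|b] [|c] [|d] /=; lia.
move=> c /andP[n1 n2]; have := count_code_upd T c fm w0.
rewrite -!val_eqE /= in n1 n2.
have -> : (T f == c) = false by lia.
have -> : (T f + w == c) = false by lia.
by rewrite !addn0 => ->.
Qed.

Lemma distinct_codes_full T m N :
  (N <= distinct_codes T m N) <-> (forall c, c < N -> exists2 f, f < m & T f = c).
Proof.
split=> [le c lc|h].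
  have : 0 < count_code T m c.
    rewrite lt0n; apply/negP=> /eqP c0; move: le; apply/negP; rewrite -ltnNge.
    rewrite /distinct_codes (bigD1 (Ordinal lc)) //= c0 add0n.
    rewrite -[ltnRHS]card_ord -sum1_card [ltnRHS](bigD1 (Ordinal lc)) //=.
    by rewrite add1n ltnS; apply: leq_sum => i _; apply: leq_b1.
  rewrite /count_code; case: (pickP (fun f : 'I_m => T f == c)) => [f /eqP <- _|no].
    by exists f.
  by rewrite big1 // => i _; rewrite no.
rewrite -[leqLHS]card_ord -sum1_card; apply: leq_sum => c _.
by have [f fm <-] := h c (ltn_ord c); rewrite count_code_gt0.
Qed.

Lemma shattered_codes (V : finType) (H : {set {set V}}) (es : seq (seq V)) (S : seq V) :
  [seq [set v in e]%SET | e <- es] =i H -> uniq S ->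
  shattered H [set v in S] =
  (2 ^ size S <= distinct_codes
     (fun f => trace_code S [set v in nth [::] es f]) (size es) (2 ^ size S)).
Proof.
move=> eqH uS.
have inH f : f < size es -> [set v in nth [::] es f]%SET \in H.
  by move=> lf; rewrite -eqH map_f // mem_nth.
apply/idP/idP=> [/forallP sh|/distinct_codes_full full].
  apply/distinct_codes_full => c lc; have [A AS <-] := trace_code_surj uS lc.
  have /imsetP[e] : A \in induced H [set v in S].
    by apply: (implyP (sh A)); apply/subsetP=> x /(subsetP AS); rewrite inE.
  rewrite -eqH => /mapP[d /(nthP [::])[f lf <-] ->] eA; exists f => //.
  by apply/eq_trace_code => x xS; rewrite eA !inE xS andbT.
apply/forallP=> A; apply/implyP=> /subsetP AS.
have [f lf /eq_trace_code ef] := full _ (trace_code_lt S A).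
apply/imsetP; exists [set v in nth [::] es f]; first exact: inH.
apply/setP=> x; rewrite !inE; have [xS|xS] := boolP (x \in S).
  by rewrite -ef // inE andbT.
by rewrite andbF; apply/negbTE; apply: contra xS => /AS; rewrite inE.
Qed.

(** * Weakest preconditions with running time *)

(** Being existential, it asserts termination as well; [Q] also receives the cost. *)
Definition wp (c : cmd) (s : wstate) (Q : wstate -> nat -> Prop) : Prop :=
  exists s' k, exec c s k s' /\ Q s' k.

Lemma wp_mono c s (Q Q' : wstate -> nat -> Prop) :
  wp c s Q -> (forall s' k, Q s' k -> Q' s' k) -> wp c s Q'.
Proof. by move=> [s' [k [E q]]] QQ; exists s', k; split; auto. Qed.

(** The new value enters as a variable with an equation, which keeps the states small during
    symbolic execution. *)
Lemma wp_assign i e s (Q : wstate -> nat -> Prop) :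
  (forall v, v = eval s e -> Q (set_var s i v) 1) -> wp (Assign i e) s Q.
Proof. by move=> q; eexists; eexists; split; [exact: ExecAssign|exact: q]. Qed.

Lemma wp_put a e1 e2 s (Q : wstate -> nat -> Prop) :
  (forall j v, j = eval s e1 -> v = eval s e2 -> Q (set_arr s a j v) 1) ->
  wp (Put a e1 e2) s Q.
Proof. by move=> q; eexists; eexists; split; [exact: ExecPut|exact: q]. Qed.

Lemma wp_input i s (Q : wstate -> nat -> Prop) :
  Q (read_var s i) 1 -> wp (Input i) s Q.
Proof. by move=> q; eexists; eexists; split; [exact: ExecInput|]. Qed.

Lemma wp_seq c1 c2 s (Q : wstate -> nat -> Prop) :
  wp c1 s (fun s1 k1 => wp c2 s1 (fun s2 k2 => Q s2 (k1 + k2))) ->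
  wp (Seq c1 c2) s Q.
Proof.
move=> [s1 [k1 [E1 [s2 [k2 [E2 q]]]]]].
by exists s2, (k1 + k2); split=> //; apply: ExecSeq E1 E2.
Qed.

(** * Frame conditions and loops *)

Fixpoint vars_of (c : cmd) : seq nat :=
  match c with
  | Assign i _ | Input i => [:: i]
  | Put _ _ _ => [::]
  | Seq c1 c2 => vars_of c1 ++ vars_of c2
  | While _ c1 => vars_of c1
  end.

Fixpoint arrs_of (c : cmd) : seq nat :=
  match c with
  | Put a _ _ => [:: a]
  | Seq c1 c2 => arrs_of c1 ++ arrs_of c2
  | While _ c1 => arrs_of c1
  | _ => [::]
  end.

(** What a command does not write is read off its text, so loop invariants need mention only what
    changes. *)
Definition frame (c : cmd) (s s' : wstate) : Prop :=
  (forall i, i \notin vars_of c -> var s' i = var s i) /\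
  (forall a, a \notin arrs_of c -> arr s' a = arr s a).

Lemma frame_trans c s1 s2 s3 : frame c s1 s2 -> frame c s2 s3 -> frame c s1 s3.
Proof. by move=> [v1 a1] [v2 a2]; split=> x nx; rewrite ?v2 ?v1 ?a2 ?a1. Qed.

Lemma frame_refl c s : frame c s s.
Proof. by []. Qed.

Lemma exec_frame c s k s' : exec c s k s' -> frame c s s'.
Proof.
elim=> {c s k s'} //.
- by move=> i e s; split=> //= j; rewrite inE => /negbTE->.
- by move=> a e1 e2 s; split=> //= b; rewrite inE => /negbTE->.
- by move=> i s; split=> //= j; rewrite inE => /negbTE->.
- move=> c1 c2 s k1 s1 k2 s2 _ [v1 a1] _ [v2 a2].
  by split=> x /=; rewrite mem_cat negb_or => /andP[n1 n2]; rewrite ?v2 ?v1 ?a2 ?a1.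
- move=> e c s k1 s1 k2 s2 _ _ f1 _ f2; exact: frame_trans f1 f2.
Qed.

Lemma wp_frame c s (Q : wstate -> nat -> Prop) :
  wp c s Q -> wp c s (fun s' k => Q s' k /\ frame c s s').
Proof. by move=> [s' [k [E q]]]; exists s', k; split=> //; split=> //; apply: exec_frame E. Qed.

(* In [I m s], [m] bounds the number of iterations still to come. *)
Lemma wp_while e c s0 (I : nat -> wstate -> Prop) b m :
  I m s0 ->
  (forall m s, I m s -> frame c s0 s -> 0 < eval s e ->
     wp c s (fun s' k => k <= b /\ exists2 m', m' < m & I m' s')) ->
  wp (While e c) s0 (fun s' k => [/\ k <= m * b.+1 + 1, frame c s0 s',
     eval s' e = 0 & exists m', I m' s']).
Proof.
move=> + step; move: (frame_refl c s0); move: {2 3 4}s0.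
have [n] := ubnP m; elim: n m => // n IH m /ltnSE le_mn s F Is.
have [e0|e0] := posnP (eval s e).
  exists s, 1; split; first exact: ExecWhileF.
  by split=> //; [lia|exists m].
have [s1 [k1 [E1 [le1 [m' lt' I1]]]]] := step m s Is F e0.
have [s2 [k2 [E2 [le2 F2 z2 I2]]]] :=
  IH m' (leq_trans lt' le_mn) s1 (frame_trans F (exec_frame E1)) I1.
exists s2, (1 + k1 + k2); split; first exact: ExecWhileT E1 E2.
split=> //; nia.
Qed.

Lemma wp_compiled c x (Q : wstate -> nat -> Prop) :
  wf_cmd c -> wp c (WState (fun=> 0) (fun _ _ => 0) x) Q ->
  exists s k t, [/\ Q s k, outputs_within (ccmd 0 c) x t (var s 0) &
                    t <= size (ccmd 0 c) * k].
Proof.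
move=> wf [s [k [E q]]].
have A : code_at (ccmd 0 c) 0 (ccmd 0 c) by exists [::], [::]; rewrite cats0.
have R : represents (fun=> 0) (WState (fun=> 0) (fun _ _ => 0) x) by [].
have [t [r [Et [hv _] le_t]]] := exec_compiled E wf A R.
exists s, k, t; split=> //; rewrite /outputs_within /init Et.
by split=> //=; rewrite -(hv 0).
Qed.

(** * The program *)

Infix ";;" := Seq (at level 61, right associativity).

(* The vertices of the edges are read onto the tape [aVert]; [aFirst], [aNext] and
   [aEdge] form the incidence lists, linking tape positions. The queue extends from
   [vH] to [vT]. Its entry [i] is the empty set if [aSize i = 0], and otherwise adds
   the vertex at tape position [aPos i] to the set of entry [aPar i]. During a test,
   [aTr (vB + f)] is the trace code of edge [f], [aCnt (vO + c)] the number of edges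
   with code [c], and [vD] the number of codes that occur. The offsets [vB] and [vO]
   advance after each test, so that the next one finds cells that are still 0.
   Since subtraction is truncated, [1 - x] tests [x = 0] and [x + (y - x)] is the
   maximum of [x] and [y]. *)
Notation vAns := 0 (only parsing).
Notation vM := 1 (only parsing).
Notation vJ := 2 (only parsing).
Notation vP := 3 (only parsing).
Notation vS := 4 (only parsing).
Notation vV := 5 (only parsing).
Notation vH := 6 (only parsing).
Notation vT := 7 (only parsing).
Notation vD := 8 (only parsing).
Notation vW := 9 (only parsing).
Notation vA := 10 (only parsing).
Notation vQ := 11 (only parsing).
Notation vB := 12 (only parsing).
Notation vO := 13 (only parsing).
Notation vF := 14 (only parsing).
Notation vC := 15 (only parsing).
Notation vOk := 16 (only parsing).
Notation aVert := 0 (only parsing).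
Notation aEdge := 1 (only parsing).
Notation aNext := 2 (only parsing).
Notation aFirst := 3 (only parsing).
Notation aPos := 4 (only parsing).
Notation aPar := 5 (only parsing).
Notation aSize := 6 (only parsing).
Notation aTr := 7 (only parsing).
Notation aCnt := 8 (only parsing).

Definition read_vertex : cmd :=
  Assign vP (Sum (Var vP) (Cst 1)) ;;
  Input vV ;;
  Assign vV (Sum (Var vV) (Cst 1)) ;;
  Put aVert (Var vP) (Var vV) ;;
  Put aEdge (Var vP) (Var vJ) ;;
  Put aNext (Var vP) (Get aFirst (Var vV)) ;;
  Put aFirst (Var vV) (Var vP) ;;
  Assign vS (Diff (Var vS) (Cst 1)).

(** Edge [j] also becomes queue entry [j], the empty set, placed at the separator before the edge,
    so that [expand] starts at the first vertex. Position 0 is a separator, which leaves 0 free to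
    mark the end of an incidence list. *)
Definition read_edge : cmd :=
  Put aPos (Var vJ) (Var vP) ;;
  Input vS ;;
  While (Var vS) read_vertex ;;
  Assign vP (Sum (Var vP) (Cst 1)) ;;
  Assign vJ (Sum (Var vJ) (Cst 1)).

Definition read_all : cmd :=
  Input vV ;;
  Input vM ;;
  While (Diff (Var vM) (Var vJ)) read_edge.

Definition visit_edge : cmd :=
  Assign vF (Sum (Get aEdge (Var vQ)) (Var vB)) ;;
  Assign vC (Sum (Get aTr (Var vF)) (Var vO)) ;;
  Put aCnt (Var vC) (Diff (Get aCnt (Var vC)) (Cst 1)) ;;
  Assign vD (Diff (Var vD) (Diff (Cst 1) (Get aCnt (Var vC)))) ;;
  Put aTr (Var vF) (Sum (Get aTr (Var vF)) (Var vW)) ;;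
  Assign vC (Sum (Var vC) (Var vW)) ;;
  Assign vD (Sum (Var vD) (Diff (Cst 1) (Get aCnt (Var vC)))) ;;
  Put aCnt (Var vC) (Sum (Get aCnt (Var vC)) (Cst 1)) ;;
  Assign vQ (Get aNext (Var vQ)).

Definition visit_vertex : cmd :=
  Assign vQ (Get aFirst (Get aVert (Get aPos (Var vA)))) ;;
  While (Var vQ) visit_edge ;;
  Assign vW (Sum (Var vW) (Var vW)) ;;
  Assign vA (Get aPar (Var vA)).

(** Before any vertex is visited all edges have code 0: the fresh trace cells say so already, and a
    single counter has to be set. The final [vW] is the number of possible codes, hence the advance
    of [vO]. *)
Definition count_traces : cmd :=
  Put aCnt (Var vO) (Var vM) ;;
  Assign vD (Cst 1) ;;
  Assign vW (Cst 1) ;;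
  Assign vA (Var vH) ;;
  While (Get aSize (Var vA)) visit_vertex ;;
  Assign vB (Sum (Var vB) (Var vM)) ;;
  Assign vO (Sum (Var vO) (Var vW)).

Definition push : cmd :=
  Put aPos (Var vT) (Var vQ) ;;
  Put aPar (Var vT) (Var vH) ;;
  Put aSize (Var vT) (Sum (Get aSize (Var vH)) (Cst 1)) ;;
  Assign vT (Sum (Var vT) (Cst 1)) ;;
  Assign vQ (Sum (Var vQ) (Cst 1)).

Definition expand : cmd :=
  Assign vAns (Sum (Var vAns) (Diff (Get aSize (Var vH)) (Var vAns))) ;;
  Assign vQ (Sum (Get aPos (Var vH)) (Cst 1)) ;;
  While (Get aVert (Var vQ)) push ;;
  Assign vOk (Cst 0).

(** The loop on [vOk] is a conditional, as [expand] resets the flag; the flag is 1 exactly when [vD]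
    has reached [vW]. *)
Definition process : cmd :=
  count_traces ;;
  Assign vOk (Diff (Cst 1) (Diff (Var vW) (Var vD))) ;;
  While (Var vOk) expand ;;
  Assign vH (Sum (Var vH) (Cst 1)).

Definition vc_cmd : cmd :=
  read_all ;;
  Assign vT (Var vM) ;;
  While (Diff (Var vT) (Var vH)) process.

(** * Testing whether a set is shattered *)

(* The bound [b] on the cells of a list makes the cells above it free for allocation. *)
Fixpoint chain (next edge : nat -> nat) (b q : nat) (l : seq nat) : Prop :=
  match l with
  | [::] => q = 0
  | f :: l' => [/\ 0 < q, q <= b, edge q = f & chain next edge b (next q) l']
  end.

Arguments chain : simpl never.

Lemma chain_upd next edge b b' q l x y :
  b < b' -> chain next edge b q l -> chain (upd next b' x) (upd edge b' y) b' q l.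
Proof.
move=> lb; elim: l q => // f l IH q [q0 qb <- h].
by split; rewrite ?upd_other; try lia; apply: IH.
Qed.

(* Edge [f] has trace code [T f], stored at offset [vB] and counted at offset [vO]. *)
Definition tally (T : nat -> nat) (N : nat) (s : wstate) : Prop :=
  [/\ forall f, f < var s vM -> arr s aTr (var s vB + f) = T f,
      forall c, arr s aCnt (var s vO + c) = count_code T (var s vM) c,
      var s vD = distinct_codes T (var s vM) N &
      forall x, var s vB + var s vM <= x -> arr s aTr x = 0].

Lemma wp_visit_edge s T N b f l :
  tally T N s -> 0 < var s vW -> f < var s vM -> T f + var s vW < N ->
  chain (arr s aNext) (arr s aEdge) b (var s vQ) (f :: l) ->
  wp visit_edge s (fun s' k => [/\ k = 9, tally (upd T f (T f + var s vW)) N s' &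
    chain (arr s aNext) (arr s aEdge) b (var s' vQ) l]).
Proof.
move=> [tT tC tD tZ] w0 fm lN [q0 qb ef ch].
rewrite /visit_edge.
apply: wp_seq; apply: wp_assign => x /= ex.
apply: wp_seq; apply: wp_assign => c /= ec.
apply: wp_seq; apply: wp_put => _ v1 /= -> e1.
apply: wp_seq; apply: wp_assign => d1 /= ed1.
apply: wp_seq; apply: wp_put => _ v2 /= -> e2.
apply: wp_seq; apply: wp_assign => c' /= ec'.
apply: wp_seq; apply: wp_assign => d2 /= ed2.
apply: wp_seq; apply: wp_put => _ v3 /= -> e3.
apply: wp_assign => _ /= ->.
have {}ex : x = var s vB + f by lia.
have {}ec : c = var s vO + T f by rewrite ec ex tT // addnC.
have {}ec' : c' = var s vO + (T f + var s vW) by lia.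
rewrite ex tT // in e2; rewrite ec tC in e1.
rewrite ec ec' upd_other ?tC in e3; last by lia.
rewrite ed1 ec ec' upd_same upd_other ?tC in ed2; last by lia.
have cnt := count_code_upd T _ fm w0.
split=> //; split=> /=.
- move=> g gm; have [->|/eqP ne] := eqVneq g f; first by rewrite ex !upd_same.
  by rewrite !upd_other ?tT //; lia.
- move=> g; have := cnt g.
  have [<-|/eqP n1] := eqVneq (T f + var s vW) g.
    by rewrite ec' upd_same; lia.
  rewrite upd_other; last by lia.
  have [<-|/eqP n2] := eqVneq (T f) g; first by rewrite ec upd_same; lia.
  by rewrite upd_other ?tC; lia.
- by rewrite distinct_codes_upd // ed2 e1 tD.
- by move=> y ly; rewrite upd_other ?tZ //; lia.
Qed.

Lemma tally_ext T T' N s : T =1 T' -> tally T N s -> tally T' N s.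
Proof.
move=> e [tT tC tD tZ].
have ec c : count_code T (var s vM) c = count_code T' (var s vM) c.
  by apply: eq_bigr => f _; rewrite e.
split=> // [f fm|c|]; rewrite ?tT ?tC ?tD ?e //.
by apply: eq_bigr => c _; rewrite ec.
Qed.

Lemma wp_visit_edges s T N b l :
  tally T N s -> 0 < var s vW -> uniq l ->
  (forall f, f \in l -> f < var s vM /\ T f + var s vW < N) ->
  chain (arr s aNext) (arr s aEdge) b (var s vQ) l ->
  wp (While (Var vQ) visit_edge) s (fun s' k =>
    k <= size l * 10 + 1 /\ tally (fun f => T f + var s vW * (f \in l)) N s').
Proof.
move=> t w0 ul hl ch.
(* [l2] is the part of the list still ahead; the current codes plus its pending contributions stay
   constant. *)
pose I r s' := exists l2 T', [/\ size l2 = r, uniq l2 /\ {subset l2 <= l}, tally T' N s',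
  chain (arr s' aNext) (arr s' aEdge) b (var s' vQ) l2 &
  forall f, T' f + var s vW * (f \in l2) = T f + var s vW * (f \in l)].
apply: wp_mono (wp_while (I := I) (b := 9) (m := size l) _ _) _.
- by exists l, T; split=> //; split.
- move=> r s1 [[|f l2] [T' [sz [u2 sub] t' ch' eT]]] F /=; first by rewrite ch'.
  have eW : var s1 vW = var s vW by apply: F.1.
  have eM : var s1 vM = var s vM by apply: F.1.
  case/andP: u2 => fl2 u2 _.
  have [fM fN] := hl f (sub f (mem_head _ _)).
  have := eT f; rewrite mem_head sub ?mem_head // => /addIn eTf.
  apply: wp_mono (wp_frame (wp_visit_edge t' _ _ _ ch')) _; rewrite ?eW ?eM ?eTf //.
  move=> s2 k [[-> t2 ch2] F2]; split=> //; exists (size l2); first by rewrite -sz.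
  exists l2, (upd T' f (T' f + var s vW)); split=> //.
  + by split=> // x xl; apply: sub; rewrite inE xl orbT.
  + by rewrite eTf.
  + by rewrite (F2.2 aNext) // (F2.2 aEdge).
  + move=> g; have := eT g; rewrite inE; have [->|/eqP ne] := eqVneq g f.
      by rewrite upd_same (negbTE fl2) /=; lia.
    by rewrite upd_other.
- move=> s1 k [le_k _ z [r [l2 [T' [_ _ t' ch' eT]]]]]; split=> //.
  case: l2 ch' eT => [_ eT|f l2 [q0]]; last by move: z q0 => /= ->.
  by apply: tally_ext t' => f; rewrite -eT muln0 addn0.
Qed.

Definition incidence (V : finType) (u : V -> nat) (es : seq (seq V)) (r b : nat)
    (s : wstate) : Prop :=
  forall v, exists l,
    [/\ chain (arr s aNext) (arr s aEdge) b (arr s aFirst (u v)) l, uniq l,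
        size l <= r & forall f, (f \in l) = (v \in nth [::] es f)].

(** The parent links list the set with the latest vertex in front; the bound [b] keeps them inside
    the queue, out of reach of later pushes. *)
Fixpoint item_path (V : finType) (u : V -> nat) (s : wstate) (b a : nat) (S : seq V) : Prop :=
  [/\ a < b, arr s aSize a = size S &
  if S is v :: S' then
    arr s aVert (arr s aPos a) = u v /\ item_path u s b (arr s aPar a) S'
  else True].

Lemma item_path_eq (V : finType) (u : V -> nat) s s' b b' a S :
  b <= b' ->
  (forall x, x < b -> [/\ arr s' aSize x = arr s aSize x, arr s' aPos x = arr s aPos x &
     arr s' aPar x = arr s aPar x]) ->
  arr s' aVert = arr s aVert ->
  item_path u s b a S -> item_path u s' b' a S.
Proof.
move=> lb e1 e2; elim: S a => [|v S IH] a /= [lt_ab hs]; have [eS eP eA] := e1 a lt_ab.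
  by rewrite eS hs; split=> //; apply: leq_trans lb.
by rewrite eS eP eA e2 hs => -[-> h]; split; [apply: leq_trans lb| |split=> //; apply: IH].
Qed.

Lemma wp_count_traces (V : finType) (u : V -> nat) (es : seq (seq V)) r b b' s S :
  var s vM = size es -> 0 < size es -> incidence u es r b s ->
  item_path u s b' (var s vH) S -> uniq S ->
  (forall x, var s vB <= x -> arr s aTr x = 0) ->
  (forall x, var s vO <= x -> arr s aCnt x = 0) ->
  wp count_traces s (fun s' k =>
    [/\ k <= size S * (r * 10 + 5) + 7, var s' vW = 2 ^ size S,
        var s' vD = distinct_codes
          (fun f => trace_code S [set v in nth [::] es f]) (size es) (2 ^ size S),
        forall x, var s' vB <= x -> arr s' aTr x = 0 &
        forall x, var s' vO <= x -> arr s' aCnt x = 0]).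
Proof.
move=> eM m0 inc pS uS zT zC; set N := 2 ^ size S.
pose T S f := trace_code S [set v in nth [::] es f].
rewrite /count_traces.
apply: wp_seq; apply: wp_put => _ _ /= -> ->.
apply: wp_seq; apply: wp_assign => _ /= ->.
apply: wp_seq; apply: wp_assign => _ /= ->.
apply: wp_seq; apply: wp_assign => _ /= ->.
set s0 := set_var _ vA _.
(* [S1] has been visited and [S2] lies ahead; the codes are those on [S1], and [vW] is the weight of
   the next digit. *)
pose I r s' := exists S1 S2, [/\ S = S1 ++ S2, size S2 = r, item_path u s' b' (var s' vA) S2,
  var s' vW = 2 ^ size S1 & tally (T S1) N s'].
apply: wp_seq; apply: wp_mono (wp_while (I := I) (b := r * 10 + 4) (m := size S) _ _) _.
- exists [::], S; split=> //; first exact: item_path_eq pS.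
  split=> /=.
  + by move=> f _; rewrite zT // leq_addr.
  + move=> c; rewrite /count_code; have [->|/eqP c0] := eqVneq c 0.
      rewrite addn0 upd_same (eq_bigr (fun=> 1)) ?sum1_card ?card_ord //.
    rewrite upd_other ?zC ?big1 ?leq_addr //; lia.
  + have N0 : 0 < N by rewrite expn_gt0.
    rewrite /distinct_codes (bigD1 (Ordinal N0)) //= big1 => [|c c0].
      by rewrite (@count_code_gt0 (T [::]) _ 0) // eM.
    apply/eqP; rewrite eqb0 -leqNgt leqn0; apply/eqP; apply: big1 => f _.
    by apply/eqP; rewrite eqb0; apply: contra c0 => /eqP e; apply/eqP/val_inj.
  + by move=> x lx; apply: zT; apply: leq_trans lx; apply: leq_addr.
- move=> n s1 [S1 [[|v S2] [eS sz [_ hs hp] eW t]]] F /=; first by rewrite hs.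
  case: hp => hv hp _.
  have eM1 : var s1 vM = size es by rewrite -eM; apply: F.1.
  have [l [ch ul szl hl]] := inc v.
  apply: wp_seq; apply: wp_assign => q /= eq.
  apply: wp_seq.
  have : tally (T S1) N (set_var s1 vQ q) by [].
  move/(@wp_visit_edges _ _ _ b l) => /= /(_ _ ul) W.
  have sS : size S1 + size S2 < size S by rewrite eS size_cat /= addnS.
  apply: wp_mono (wp_frame (W _ _ _)) _; rewrite ?eW ?expn_gt0 // {W}.
  + move=> f fl; rewrite eM1; split.
      by rewrite ltnNge; apply/negP=> le; move: fl; rewrite hl nth_default.
    apply: (@leq_trans (2 ^ (size S1).+1)); last by rewrite leq_exp2l //; lia.
    by rewrite expnS mul2n -addnn ltn_add2r trace_code_lt.
  + by rewrite eq hv (F.2 aNext) // (F.2 aEdge) // (F.2 aFirst).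
  move=> s2 k [[le_k t2] F2].
  apply: wp_seq; apply: wp_assign => w /= ew.
  apply: wp_assign => a /= ea.
  split; first by nia.
  exists (size S2); first by rewrite -sz.
  exists (rcons S1 v), S2; split=> //=.
  + by rewrite eS cat_rcons.
  + have eA : var s2 vA = var s1 vA by apply: F2.1.
    rewrite ea eA (F2.2 aPar) //; by apply: item_path_eq hp => //= *; rewrite !F2.2.
  + by rewrite ew (F2.1 vW) //= eW size_rcons expnS mul2n addnn.
  + case: (tally_ext _ t2 : tally (T (rcons S1 v)) N s2) => // f.
    by rewrite /T trace_code_rcons inE hl.
- move=> s1 k [le_k F z [n [S1 [S2 [eS _ hp eW [tT tC tD tZ]]]]]].
  have eS1 : S = S1.
    by case: S2 hp eS => [|v S2 [_ hs]]; [rewrite cats0|move: z => /=; rewrite hs].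
  rewrite -eS1 in eW tT tC tD.
  have eM1 : var s1 vM = size es by rewrite -eM; apply: F.1.
  apply: wp_seq; apply: wp_assign => x /= ->; apply: wp_assign => y /= ->.
  split=> //; first by lia.
  + by rewrite tD eM1.
  (* All codes are below [N], so the counters from the advanced offset on are still 0. *)
  + move=> c lc; have -> : c = var s1 vO + (c - var s1 vO) by lia.
    rewrite tC /count_code big1 // => f _; apply/eqP; rewrite eqb0; apply/eqP => e.
    have : T S f < N by apply: trace_code_lt.
    by rewrite e; lia.
Qed.

(** * The breadth-first search *)

(** An entry pairs the chosen vertices, latest first, with the part of the edge after the latest
    choice. *)
Fixpoint children (V : Type) (S R : seq V) : seq (seq V * seq V) :=
  if R is v :: R' then (v :: S, R') :: children S R' else [::].

Definition item (V : Type) (Q : seq (seq V * seq V)) (i : nat) : seq V * seq V :=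
  nth ([::], [::]) Q i.

(** At [t = size (item Q i).2] the default of [nth] demands a 0 on the tape, on which the loop of
    [expand] stops. *)
Definition stored (V : finType) (u : V -> nat) (s : wstate) (Q : seq (seq V * seq V)) : Prop :=
  forall i, i < size Q ->
    item_path u s (size Q) i (item Q i).1 /\
    forall t, t <= size (item Q i).2 ->
      arr s aVert (arr s aPos i + t.+1) = nth 0 (map u (item Q i).2) t.

Lemma wp_push (V : finType) (u : V -> nat) s Q v S R :
  stored u s Q -> var s vT = size Q -> var s vH < size Q -> (item Q (var s vH)).1 = S ->
  (forall t, t <= (size R).+1 -> arr s aVert (var s vQ + t) = nth 0 (map u (v :: R)) t) ->
  wp push s (fun s' k => [/\ k = 5, stored u s' (rcons Q (v :: S, R)),
    var s' vT = (size Q).+1 & var s' vQ = (var s vQ).+1]).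
Proof.
move=> st eT lh eS hR; rewrite /push.
apply: wp_seq; apply: wp_put => _ _ /= -> ->.
apply: wp_seq; apply: wp_put => _ _ /= -> ->.
apply: wp_seq; apply: wp_put => _ z /= -> ez.
apply: wp_seq; apply: wp_assign => _ /= ->.
apply: wp_assign => _ /= ->; rewrite eT !addn1; split=> // i.
have [ih _] := st _ lh.
have {}ez : z = (size S).+1.
  by rewrite ez -eS addn1; case: (item Q _).1 ih => [|? ?] [_ ->].
rewrite size_rcons ltnS leq_eqVlt => /orP[/eqP-> {i}|li]; last first.
  have [p1 p2] := st i li; rewrite /item nth_rcons li -/(item Q i); split.
    apply: item_path_eq p1 => //= x lx; rewrite !upd_other //; lia.
  by move=> t lt; rewrite /= upd_other ?p2 //; lia.
rewrite /item nth_rcons ltnn eqxx /=; split; last first.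
  by move=> t lt; rewrite upd_same addnS -addSn addSnnS hR.
rewrite !upd_same ez; split=> //; split.
  by have := hR 0 isT; rewrite addn0.
rewrite -eS; apply: item_path_eq ih => //= x lx; rewrite !upd_other //; lia.
Qed.

Lemma wp_push_loop (V : finType) (u : V -> nat) s Q S R :
  (forall v, 0 < u v) ->
  stored u s Q -> var s vT = size Q -> var s vH < size Q -> item Q (var s vH) = (S, R) ->
  var s vQ = (arr s aPos (var s vH)).+1 ->
  wp (While (Get aVert (Var vQ)) push) s (fun s' k => [/\ k <= size R * 6 + 1,
    stored u s' (Q ++ children S R) & var s' vT = size (Q ++ children S R)]).
Proof.
move=> u0 st eT lh eI eQ; have [_ hR] := st _ lh; rewrite eI /= in hR.
(* [R1] remains to be pushed; [Q1 ++ children S R1] is always the final queue. *)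
pose I r s' := exists Q1 R1, [/\ size R1 = r, stored u s' Q1, var s' vT = size Q1,
  [/\ Q1 ++ children S R1 = Q ++ children S R, var s vH < size Q1 &
      (item Q1 (var s vH)).1 = S] &
  forall t, t <= size R1 -> arr s' aVert (var s' vQ + t) = nth 0 (map u R1) t].
apply: wp_mono (wp_while (I := I) (b := 5) (m := size R) _ _) _.
- exists Q, R; split=> //; first by rewrite eI.
  by move=> t lt; rewrite eQ addSnnS hR.
- move=> r s1 [Q1 [[|v R1] [sz st1 eT1 [eQ1 lh1 eS1] hR1]]] F /=.
    by have := hR1 0 isT; rewrite addn0 /= => ->.
  move=> _; have eh : var s1 vH = var s vH by apply: F.1.
  rewrite -eh in lh1 eS1.
  apply: wp_mono (wp_frame (wp_push st1 eT1 lh1 eS1 hR1)) _.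
  move=> s2 k [[-> st2 eT2 eQ2] F2]; split=> //; exists (size R1); first by rewrite -sz.
  exists (rcons Q1 (v :: S, R1)), R1; split=> //.
  + by rewrite size_rcons.
  + split; first by rewrite cat_rcons.
      by rewrite size_rcons -eh ltnW // ltnS.
    by rewrite /item nth_rcons -eh lh1.
  + by move=> t lt; rewrite eQ2 addSnnS (F2.2 aVert) // hR1.
- move=> s1 k [le_k F z [r [Q1 [[|v R1] [sz st1 eT1 [eQ1 _ _] hR1]]]]].
    by rewrite cats0 in eQ1; rewrite -eQ1.
  by move: (hR1 0 isT) (u0 v) z; rewrite addn0 /= => -> ; case: (u v).
Qed.

(** For a loop used as a conditional: its body clears the guard. *)
Lemma wp_while_once e c s (Q : wstate -> nat -> Prop) :
  (eval s e = 0 -> Q s 1) ->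
  (0 < eval s e -> wp c s (fun s' k => eval s' e = 0 /\ Q s' (1 + k + 1))) ->
  wp (While e c) s Q.
Proof.
move=> q0 q1; have [e0|e0] := posnP (eval s e).
  by exists s, 1; split; [exact: ExecWhileF|exact: q0].
have [s1 [k [E [z q]]]] := q1 e0; exists s1, (1 + k + 1); split=> //.
exact: ExecWhileT e0 E (ExecWhileF _ z).
Qed.

Lemma children_suffix (V : eqType) (S R : seq V) v l :
  subseq (v :: l) R -> exists2 R', (v :: S, R') \in children S R & subseq l R'.
Proof.
elim: R => //= x R IH; have [<- sub|_ /IH[R' h1 h2]] := eqVneq v x.
  by exists R; rewrite ?mem_head.
by exists R' => //; rewrite inE h1 orbT.
Qed.

(* Every shattered set lies in an edge, and by heredity all the prefixes of its
   listing in the order of that edge are processed and extended. *)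
Lemma queue_complete (V : finType) (H : {set {set V}}) (es : seq (seq V))
    (Q : seq (seq V * seq V)) ans :
  [seq [set v in e]%SET | e <- es] =i H ->
  {in es, forall e, ([::], e) \in Q} ->
  {in Q, forall it, shattered H [set v in it.1] ->
     {subset children it.1 it.2 <= Q} /\ size it.1 <= ans} ->
  vc H <= ans.
Proof.
move=> eqH roots closed; have [-> //|v0] := posnP (vc H).
have [S sh <-] := vc_attained v0.
have : S \in induced H S by apply: (implyP (forallP sh S)).
case/imsetP=> e0; rewrite -eqH => /mapP[e ee ->] eS.
have key l2 l1 R : (rev l1, R) \in Q -> subseq l2 R -> S =i l1 ++ l2 ->
    size l1 + size l2 <= ans.
  elim: l2 l1 R => [|x l2 IH] l1 R iQ sub eSl.
    rewrite addn0 -size_rev; apply: (closed _ iQ _).2.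
    by rewrite (_ : [set v in _] = S) //; apply/setP=> v; rewrite inE mem_rev eSl cats0.
  have sh1 : shattered H [set v in rev l1].
    apply: shattered_sub sh _; apply/subsetP=> v.
    by rewrite inE mem_rev eSl mem_cat => ->.
  have [R' h1 h2] := children_suffix (rev l1) sub.
  rewrite /= -addSnnS -(size_rcons l1 x); apply: (IH _ R') => //.
    by rewrite rev_rcons; apply: (closed _ iQ sh1).1.
  by move=> v; rewrite eSl cat_rcons.
have eSl : S =i [seq v <- e | v \in S].
  by move=> v; rewrite mem_filter [in LHS]eS !inE andbC; case: (v \in S) => //; rewrite andbF.
rewrite (eq_card eSl); apply: leq_trans (card_size _) _.
exact: (key _ [::] e (roots e ee) (filter_subseq _ _) eSl).
Qed.

(* [B ^ (K - size S)] bounds the number of descendants of an entry listing [S],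
   itself included. *)
Definition potential (V : Type) (B K : nat) (Q : seq (seq V * seq V)) : nat :=
  \sum_(it <- Q) B ^ (K - size it.1).

(** There are at most [D] children, each lighter than [S] by the factor [D.+1]; the unit left over
    pays for processing [S] itself. *)
Lemma potential_children (V : Type) (D K : nat) (S R : seq V) :
  size S < K -> size R <= D -> potential D.+1 K (children S R) < D.+1 ^ (K - size S).
Proof.
move=> lS lR; have -> : potential D.+1 K (children S R) = size R * D.+1 ^ (K - (size S).+1).
  rewrite /potential; elim: R {lR} => /= [|v R IH]; first by rewrite big_nil.
  by rewrite big_cons IH mulSn.
have -> : K - size S = (K - (size S).+1).+1 by lia.
by rewrite expnS ltn_mul2r expn_gt0 ltnS.
Qed.

Lemma drop_catl (T : Type) n (s t : seq T) :
  n <= size s -> drop n (s ++ t) = drop n s ++ t.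
Proof.
rewrite leq_eqVlt drop_cat => /orP[/eqP->|->] //.
by rewrite ltnn subnn drop0 drop_size.
Qed.

Lemma wp_expand (V : finType) (u : V -> nat) s Q S R :
  (forall v, 0 < u v) ->
  stored u s Q -> var s vT = size Q -> var s vH < size Q -> item Q (var s vH) = (S, R) ->
  wp expand s (fun s' k => [/\ k <= size R * 6 + 4, stored u s' (Q ++ children S R),
    var s' vT = size (Q ++ children S R), var s' vAns = maxn (var s vAns) (size S) &
    var s' vOk = 0]).
Proof.
move=> u0 st eT lh eI; have [ih _] := st _ lh.
have eS : arr s aSize (var s vH) = size S.
  by move: ih; rewrite eI /=; case: S {eI} => [|? ?] [_ ->].
rewrite /expand; apply: wp_seq; apply: wp_assign => a /= ea.
apply: wp_seq; apply: wp_assign => q /= eq.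
apply: wp_seq; set s0 := set_var _ vQ q.
have st0 : stored u s0 Q.
  by move=> i li; have [p1 p2] := st i li; split=> //; apply: item_path_eq p1.
apply: wp_mono (wp_frame (wp_push_loop u0 st0 eT lh eI _)) _.
  by rewrite /= eq addn1.
move=> s1 k [[le_k st1 eT1] F]; apply: wp_assign => _ /= ->.
split=> //; first by lia.
- by move=> i li; have [p1 p2] := st1 i li; split=> //; apply: item_path_eq p1.
- by rewrite F.1 //= ea eS maxnE.
Qed.

Lemma wp_bfs (V : finType) (u : V -> nat) (H : {set {set V}}) (es : seq (seq V)) r b D s :
  [seq [set v in e]%SET | e <- es] =i H -> {in es, forall e, uniq e} ->
  {in es, forall e, size e <= D} -> (forall v, 0 < u v) ->
  var s vM = size es -> incidence u es r b s ->
  stored u s [seq ([::], e) | e <- es] ->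
  var s vT = size es -> var s vH = 0 -> var s vAns = 0 ->
  (forall x, var s vB <= x -> arr s aTr x = 0) ->
  (forall x, var s vO <= x -> arr s aCnt x = 0) ->
  wp (While (Diff (Var vT) (Var vH)) process) s (fun s' k =>
    k <= size es * D.+1 ^ (vc H).+1 * ((vc H).+1 * (r * 10 + 5) + D * 6 + 17) + 1 /\
    var s' vAns = vc H).
Proof.
(* Entries extend shattered sets by one vertex, so their sizes can reach [vc H + 1]. *)
move=> eqH uE leD u0 eM inc st eT eH eA zT zC; set K := (vc H).+1.
(* Being a subsequence of its edge makes an entry free of repetitions and gives it at most [D]
   children. *)
pose good (it : seq V * seq V) :=
  (exists2 e, e \in es & subseq (rev it.1 ++ it.2) e) /\ size it.1 <= K.
pose I n s' := exists Q,
  [/\ [/\ var s' vT = size Q, var s' vH <= size Q & stored u s' Q],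
      {in Q, forall it, good it} /\ {in es, forall e, ([::], e) \in Q},
      {in take (var s' vH) Q, forall it, shattered H [set v in it.1] ->
         {subset children it.1 it.2 <= Q} /\ size it.1 <= var s' vAns},
      [/\ forall x, var s' vB <= x -> arr s' aTr x = 0,
          forall x, var s' vO <= x -> arr s' aCnt x = 0 & var s' vAns <= vc H] &
      potential D.+1 K (drop (var s' vH) Q) = n].
apply: wp_mono (wp_while (I := I) (b := K * (r * 10 + 5) + D * 6 + 16)
  (m := size es * D.+1 ^ K) _ _) _.
- exists [seq ([::], e) | e <- es]; rewrite size_map eT eH eA; split=> //.
  + split; last by move=> e ee; apply: map_f.
    by move=> _ /mapP[e ee ->]; split=> //=; exists e.
  + by rewrite take0.
  + rewrite drop0 /potential big_map /= subn0.
    by elim: (es) => [|e l IH]; rewrite ?big_nil // big_cons IH mulSn.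
- move=> n s1 [Q [[eT1 lh st1] [gQ rQ] cQ [zT1 zC1 leA] pn]] F /= lt_h.
  set i := var s1 vH in lh cQ pn lt_h.
  have li : i < size Q by lia.
  case eI: (item Q i) => [S R].
  have iQ : (S, R) \in Q by rewrite -eI mem_nth.
  have [[e ee sub] szS] := gQ _ iQ; rewrite /= in sub szS.
  have uSR : uniq (rev S ++ R) by apply: subseq_uniq sub (uE e ee).
  have uS : uniq S by move: uSR; rewrite cat_uniq rev_uniq => /andP[].
  have leR : size R <= D.
    by apply: leq_trans (leD e ee); apply: leq_trans (size_subseq sub); rewrite size_cat leq_addl.
  have dropQ : drop i Q = (S, R) :: drop i.+1 Q.
    by rewrite (drop_nth ([::], [::]) li) -/(item Q i) eI.
  have [pS _] := st1 i li; rewrite eI /= in pS.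
  (* Both outcomes of the test end alike, with [X] the entries pushed: none if [S] is not shattered,
     its children otherwise. *)
  have fin s' k X : k <= K * (r * 10 + 5) + D * 6 + 15 ->
      stored u s' (Q ++ X) -> var s' vT = size (Q ++ X) -> var s' vH = i ->
      (forall x, var s' vB <= x -> arr s' aTr x = 0) ->
      (forall x, var s' vO <= x -> arr s' aCnt x = 0) ->
      var s1 vAns <= var s' vAns -> var s' vAns <= vc H ->
      {in X, forall it, good it} -> potential D.+1 K X < D.+1 ^ (K - size S) ->
      (shattered H [set v in S] -> X = children S R /\ size S <= var s' vAns) ->
      wp (Assign vH (Sum (Var vH) (Cst 1))) s' (fun s'' k' =>
        k + k' <= K * (r * 10 + 5) + D * 6 + 16 /\ (exists2 m, m < n & I m s'')).
    move=> le_k stX eTX eHX zTX zCX leA1 leA2 gX pX cX.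
    apply: wp_assign => _ /= ->; rewrite eHX; split; first by lia.
    exists (potential D.+1 K (drop i.+1 (Q ++ X))).
      by rewrite -pn dropQ drop_catl // /potential big_cat big_cons /= addnC ltn_add2r.
    exists (Q ++ X); rewrite /= !addn1; split=> //.
    + split=> //; first by rewrite size_cat; lia.
      by move=> j lj; have [p1 p2] := stX j lj; split=> //; apply: item_path_eq p1.
    + split; last by move=> d de; rewrite mem_cat rQ.
      by move=> it; rewrite mem_cat => /orP[/gQ|/gX].
    + rewrite takel_cat // (take_nth ([::], [::]) li) -/(item Q i) eI => it.
      rewrite mem_rcons inE => /orP[/eqP-> /= sh|/cQ h sh].
        by have [-> le] := cX sh; split=> // x; rewrite mem_cat => ->; rewrite orbT.
      have [h1 h2] := h sh; split; last exact: leq_trans leA1.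
      by move=> x /h1; rewrite mem_cat => ->.
  have m0 : 0 < size es by case: (es) ee.
  have eM1 : var s1 vM = size es by rewrite -eM; apply: F.1.
  have inc1 : incidence u es r b s1.
    by move=> v; have [l h] := inc v; exists l; rewrite !F.2.
  rewrite /process; apply: wp_seq.
  apply: wp_mono (wp_frame (wp_count_traces eM1 m0 inc1 pS uS zT1 zC1)) _.
  move=> s2 k2 [[le_k2 eW2 eD2 zT2 zC2] F2].
  apply: wp_seq; apply: wp_assign => ok /= eok.
  rewrite eW2 eD2 in eok.
  set s3 := set_var s2 vOk ok.
  have st3 : stored u s3 Q.
    move=> j lj; have [p1 p2] := st1 j lj; split=> [|t lt].
      by apply: item_path_eq p1 => //= *; rewrite !F2.2.
    by rewrite /= !F2.2 // p2.
  have eT3 : var s3 vT = size Q by rewrite /= F2.1.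
  have eH3 : var s3 vH = i by rewrite /= F2.1.
  have eA3 : var s3 vAns = var s1 vAns by rewrite /= F2.1.
  have lS : size S * (r * 10 + 5) <= K * (r * 10 + 5) by rewrite leq_mul2r szS orbT.
  have shE := shattered_codes eqH uS.
  apply: wp_seq; apply: wp_while_once => /= ok0.
    apply: (@wp_mono _ _ (fun s'' k' => k2 + 2 + k' <= K * (r * 10 + 5) + D * 6 + 16 /\
      (exists2 m, m < n & I m s''))); last by move=> s' k' [le_k h]; split=> //; lia.
    apply: (fin _ _ [::]); rewrite ?cats0 //; try lia.
    by rewrite /potential big_nil expn_gt0.
  have sh : shattered H [set v in S] by rewrite shE; lia.
  have leS : size S <= vc H.
    by have := leq_vc sh; rewrite cardsE (card_uniqP uS).
  have lh3 : var s3 vH < size Q by rewrite eH3.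
  have eI3 : item Q (var s3 vH) = (S, R) by rewrite eH3.
  apply: wp_mono (wp_frame (wp_expand u0 st3 eT3 lh3 eI3)) _.
  move=> s4 k4 [[le_k4 st4 eT4 eA4 z4] F4]; split=> //.
  apply: (@wp_mono _ _ (fun s'' k' => k2 + k4 + 3 + k' <= K * (r * 10 + 5) + D * 6 + 16 /\
    (exists2 m, m < n & I m s''))); last by move=> s' k' [le_k h]; split=> //; lia.
  apply: (fin _ _ (children S R)) => //.
  + by lia.
  + by rewrite F4.1.
  + by move=> x; rewrite F4.1 // F4.2 // => /zT2.
  + by move=> x; rewrite F4.1 // F4.2 // => /zC2.
  + by rewrite eA4 eA3 leq_maxl.
  + by rewrite eA4 eA3 geq_max leA.
  + move=> it; elim: (R) (sub) => //= v R' IH sub'.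
    rewrite inE => /orP[/eqP->|]; last first.
      by apply: IH; apply: subseq_trans sub'; rewrite cat_subseq // subseq_cons.
    by split=> //=; exists e; rewrite ?rev_cons ?cat_rcons.
  + by apply: potential_children.
  + by move=> _; rewrite eA4 leq_maxr.
- move=> s1 k [le_k F z [n [Q [[eT1 lh st1] [gQ rQ] cQ [_ _ leA] pn]]]].
  split; first by apply: leq_trans le_k _; rewrite [_ + 17]addnS.
  apply/eqP; rewrite eqn_leq leA; apply: (queue_complete eqH rQ).
  have eh : var s1 vH = size Q by move: z => /=; lia.
  by rewrite eh take_size in cQ.
Qed.

(** * Reading the input *)

Lemma chain_widen next edge b b' q l :
  b <= b' -> chain next edge b q l -> chain next edge b' q l.
Proof.
by move=> lb; elim: l q => // f l IH q [q0 qb <- h]; split=> //; [lia|apply: IH].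
Qed.

(* Vertex [v] is stored as [v.+1], and each edge is preceded by a 0. *)
Definition tape (n : nat) (es : seq (seq 'I_n)) : seq nat :=
  flatten [seq 0 :: [seq (val v).+1 | v <- e] | e <- es].

Lemma tape_rcons n (es : seq (seq 'I_n)) e :
  tape (rcons es e) = tape es ++ 0 :: [seq (val v).+1 | v <- e].
Proof. by rewrite /tape map_rcons flatten_rcons. Qed.

Definition linked (n : nat) (es : seq (seq 'I_n)) (s : wstate) : Prop :=
  forall v : 'I_n, exists l,
    [/\ chain (arr s aNext) (arr s aEdge) (var s vP) (arr s aFirst v.+1) l, uniq l &
        forall f, (f \in l) = (v \in nth [::] es f)].

(** The state within an edge of which [e] has been read. Here [vP] is the last position in use,
    whereas between edges, in [layout], it is the next separator. *)
Definition reading (n : nat) (es : seq (seq 'I_n)) (e : seq 'I_n) (s : wstate) : Prop :=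
  [/\ arr s aVert =1 nth 0 (tape (rcons es e)), (var s vP).+1 = size (tape (rcons es e)),
      var s vJ = size es & linked (rcons es e) s].

Lemma wp_read_vertex n (es : seq (seq 'I_n)) e (v : 'I_n) x s :
  reading es e s -> v \notin e -> inp s = val v :: x ->
  wp read_vertex s (fun s' k =>
    [/\ k = 8, reading es (rcons e v) s', var s' vS = var s vS - 1 & inp s' = x]).
Proof.
move=> [tV tP tJ tL] ve ei.
have eT : tape (rcons es (rcons e v)) = rcons (tape (rcons es e)) (val v).+1.
  by rewrite !tape_rcons map_rcons -rcons_cons -rcons_cat.
rewrite /read_vertex; apply: wp_seq; apply: wp_assign => p /= ep.
apply: wp_seq; apply: wp_input; rewrite /read_var /= ei /=.
apply: wp_seq; apply: wp_assign => y /= ey.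
apply: wp_seq; apply: wp_put => _ _ /= -> ->.
apply: wp_seq; apply: wp_put => _ _ /= -> ->.
apply: wp_seq; apply: wp_put => _ _ /= -> ->.
apply: wp_seq; apply: wp_put => _ _ /= -> ->.
apply: wp_assign => _ /= ->.
have {}ey : y = v.+1 by lia.
have {}ep : p = (var s vP).+1 by lia.
split=> //; split=> //=.
- move=> i; rewrite eT nth_rcons -tP -ep ey; have [->|/eqP ne] := eqVneq i p.
    by rewrite upd_same ltnn.
  by rewrite upd_other // tV; case: ltnP => // le; rewrite nth_default //; lia.
- by rewrite eT size_rcons -tP ep.
- move=> w; have [l [ch ul hl]] := tL w.
  have lp : var s vP < p by lia.
  have := chain_upd (arr s aFirst y) (var s vJ) lp ch => ch'.
  rewrite /= ey tJ in ch' *; have [wv|ne] := eqVneq w v; last first.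
    exists l; split=> //=; first by rewrite upd_other //; move/eqP: ne => ne [/val_inj].
    move=> f; rewrite hl !nth_rcons; case: ltngtP => // _.
    by rewrite mem_rcons inE (negbTE ne).
  rewrite wv in hl ch' *; exists (size es :: l); split.
  + rewrite upd_same; split; [by lia|by []|by rewrite upd_same|].
    by rewrite upd_same.
  + by rewrite /= ul hl nth_rcons ltnn eqxx ve.
  + move=> f; rewrite inE hl !nth_rcons; case: ltngtP => //= _.
    by rewrite mem_rcons mem_head.
Qed.

Definition layout (n : nat) (es : seq (seq 'I_n)) (s : wstate) : Prop :=
  [/\ arr s aVert =1 nth 0 (tape es), var s vP = size (tape es), var s vJ = size es,
      linked es s &
      forall j, j < size es -> arr s aPos j = size (tape (take j es))].

Lemma wp_read_edge n (es : seq (seq 'I_n)) e x s D :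
  layout es s -> uniq e -> size e <= D ->
  inp s = size e :: [seq val v | v <- e] ++ x ->
  wp read_edge s (fun s' k =>
    [/\ k <= D * 9 + 5, layout (rcons es e) s' & inp s' = x]).
Proof.
move=> [tV tP tJ tL tA] ue leD ei.
rewrite /read_edge; apply: wp_seq; apply: wp_put => _ _ /= -> ->.
apply: wp_seq; apply: wp_input; rewrite /read_var /= ei /=.
set s0 := WState _ _ _.
pose I r s' := exists e1 e2, [/\ e = e1 ++ e2, size e2 = r, var s' vS = r,
  reading es e1 s' & inp s' = [seq val v | v <- e2] ++ x].
apply: wp_seq; apply: wp_mono (wp_while (I := I) (b := 8) (m := size e) _ _) _.
- exists [::], e; split=> //; split=> //=.
  + move=> i; rewrite tV tape_rcons nth_cat; case: ltnP => // le.
    by rewrite nth_default //; case: (i - _) => // -[].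
  + by rewrite tape_rcons size_cat /= tP addn1.
  + move=> v; have [l [ch ul hl]] := tL v; exists l; split=> // f.
    rewrite hl nth_rcons; case: ltnP => // le.
    by rewrite nth_default //; case: eqP.
- move=> r s1 [e1 [[|v e2] [ee sz eS rd ei1]]] F; first by rewrite /= eS -sz.
  move=> _; have ve : v \notin e1.
    by move: ue; rewrite ee cat_uniq /= negb_or => /and3P[_ /andP[]].
  apply: wp_mono (wp_read_vertex rd ve ei1) _.
  move=> s2 k [-> rd2 eS2 ei2]; split=> //; exists (size e2); first by rewrite -sz.
  exists (rcons e1 v), e2; split=> //; first by rewrite cat_rcons.
  by rewrite eS2 eS -sz /= subn1.
- move=> s1 k [le_k F z [r [e1 [[|v e2] [ee sz eS rd ei1]]]]]; last first.
    by move: z; rewrite /= eS -sz.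
  rewrite cats0 in ee; rewrite -ee in rd; case: rd => tV1 tP1 tJ1 tL1.
  apply: wp_seq; apply: wp_assign => _ /= ->; apply: wp_assign => _ /= ->.
  split=> //=; first by lia.
  split=> //=.
  + by rewrite addn1.
  + by rewrite size_rcons tJ1 addn1.
  + move=> v; have [l [ch ul hl]] := tL1 v; exists l; split=> //.
    by apply: chain_widen ch; rewrite /= leq_addr.
  + move=> j; rewrite F.2 //= size_rcons ltnS tJ.
    have [->|/eqP ne lj] := eqVneq j (size es).
      by rewrite upd_same -cats1 take_size_cat.
    by rewrite upd_other // tA -?cats1 ?takel_cat //; lia.
Qed.

Definition encoding (n : nat) (es : seq (seq 'I_n)) : seq nat :=
  flatten [seq size e :: [seq val v | v <- e] | e <- es].

Lemma wp_read_all n (es : seq (seq 'I_n)) D s :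
  {in es, forall e, uniq e} -> {in es, forall e, size e <= D} ->
  inp s = n :: size es :: encoding es ->
  (forall i, var s i = 0) -> (forall a i, arr s a i = 0) ->
  wp read_all s (fun s' k =>
    [/\ k <= size es * (D * 9 + 6) + 3, var s' vM = size es & layout es s']).
Proof.
move=> uE leD ei v0 a0; rewrite /read_all.
apply: wp_seq; apply: wp_input; rewrite /read_var ei /=.
apply: wp_seq; apply: wp_input; rewrite /read_var /=.
set s0 := WState _ _ _.
pose I r s' := exists es1 es2, [/\ es = es1 ++ es2, size es2 = r, layout es1 s' &
  inp s' = encoding es2].
apply: wp_mono (wp_while (I := I) (b := D * 9 + 5) (m := size es) _ _) _.
- exists [::], es; split=> //; split=> //=.
  + by move=> i; rewrite a0 nth_nil.
  + by move=> v; exists [::]; split=> // [|f]; [exact: a0|rewrite nth_nil].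
- move=> r s1 [es1 [[|e es2] [eE sz ly ei1]]] F.
    by case: ly => _ _ /= -> _ _; rewrite F.1 //= eE cats0 subnn.
  have ee : e \in es by rewrite eE mem_cat mem_head orbT.
  move=> _; apply: wp_mono (wp_read_edge ly (uE e ee) (leD e ee) ei1) _.
  move=> s2 k [le_k ly2 ei2]; split=> //; exists (size es2); first by rewrite -sz.
  by exists (rcons es1 e), es2; rewrite cat_rcons.
- move=> s1 k [le_k F z [r [es1 [es2 [eE sz ly ei1]]]]].
  have eM : var s1 vM = size es by rewrite F.1.
  case: (ly) => _ _ eJ _ _.
  have e2 : es2 = [::].
    by apply: size0nil; move: z; rewrite /= eM eJ eE size_cat; lia.
  by rewrite eE e2 cats0 in le_k eM *; split=> //; rewrite ?eM; lia.
Qed.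

(** A list without repetitions of the edges at [v] is no longer than their number. *)
Lemma layout_incidence n (es : seq (seq 'I_n)) r s :
  (forall v, count (fun e : seq 'I_n => v \in e) es <= r) -> linked es s ->
  incidence (fun v : 'I_n => v.+1) es r (var s vP) s.
Proof.
move=> dr tL v; have [l [ch ul hl]] := tL v; exists l; split=> //.
apply: leq_trans (dr v).
rewrite -[X in count _ X](mkseq_nth [::]) count_map -size_filter.
apply: uniq_leq_size => // f fl; rewrite mem_filter /= -hl fl mem_iota /=.
by rewrite add0n ltnNge; apply/negP=> le; move: fl; rewrite hl nth_default.
Qed.

Lemma layout_stored n (es : seq (seq 'I_n)) s :
  layout es s -> (forall i, arr s aSize i = 0) ->
  stored (fun v : 'I_n => v.+1) s [seq ([::], e) | e <- es].
Proof.
move=> [tV _ _ _ tA] z i; rewrite size_map => li.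
rewrite /item (nth_map [::]) //=; split; first by split.
move=> t lt; rewrite tA // tV.
rewrite -[in tape es](cat_take_drop i es) (drop_nth [::] li) -cat_rcons /tape.
rewrite map_cat flatten_cat -/(tape _) -/(tape _) tape_rcons -catA nth_cat.
rewrite ltnNge leq_addr /= addKn /= nth_cat size_map.
case: ltnP => // le; rewrite [RHS]nth_default ?size_map //.
have -> : t - size (nth [::] es i) = 0 by lia.
by case: drop.
Qed.

(** The exponent of [D.+1] exceeds that in the number of entries by one, since the time for one
    entry is also linear in [D]. In the constant, 28 comes from the search and 9 from the reading;
    the rest is slack. *)
Lemma wp_vc n (H : {set {set 'I_n}}) (es : seq (seq 'I_n)) D r x :
  [seq [set v in e]%SET | e <- es] =i H -> {in es, forall e, uniq e} ->
  {in es, forall e, size e <= D} ->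
  (forall v, count (fun e : seq 'I_n => v \in e) es <= r) ->
  x = n :: size es :: encoding es ->
  wp vc_cmd (WState (fun=> 0) (fun _ _ => 0) x) (fun s k =>
    k <= 50 * ((size es).+1 * D.+1 ^ (vc H).+2 * (vc H).+1 * r.+1) /\
    var s 0 = vc H).
Proof.
move=> eqH uE leD dr ->; rewrite /vc_cmd; apply: wp_seq.
apply: wp_mono (wp_frame (wp_read_all uE leD _ _ _)) _ => //.
move=> s1 k1 [[le_k1 eM ly] F]; apply: wp_seq; apply: wp_assign => _ /= ->.
have [_ _ _ tL _] := ly; set s2 := set_var _ vT _.
have st : stored (fun v : 'I_n => v.+1) s2 [seq ([::], e) | e <- es].
  by apply: (@layout_stored _ _ s2) => // i; rewrite /= F.2.
have inc : incidence (fun v : 'I_n => v.+1) es r (var s1 vP) s2.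
  exact: (@layout_incidence _ es r s2).
apply: wp_mono (wp_bfs (s := s2) eqH uE leD _ eM inc st eM _ _ _ _) _ => //=.
- by rewrite F.1.
- by rewrite F.1.
- by move=> i _; rewrite F.2.
- by move=> i _; rewrite F.2.
move=> s3 k3 [le_k3 eA]; split=> //.
move: (vc H) (size es) le_k1 le_k3 => v m le_k1 le_k3.
rewrite expnS; have : 0 < D.+1 ^ v.+1 by rewrite expn_gt0.
move: (D.+1 ^ v.+1) le_k3 => B le_k3 B0.
have h1 : v.+1 * (r * 10 + 5) + D * 6 + 17 <= 28 * (D.+1 * v.+1 * r.+1) by nia.
have h2 : m * B * (v.+1 * (r * 10 + 5) + D * 6 + 17) <= m * B * (28 * (D.+1 * v.+1 * r.+1)).
  by rewrite leq_mul2l h1 orbT.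
have h3 : m * (D * 9 + 6) + 3 + 3 <= 9 * (m.+1 * D.+1) by nia.
have h4 : m.+1 * D.+1 <= m.+1 * D.+1 * (B * v.+1 * r.+1).
  by rewrite leq_pmulr // !muln_gt0 B0.
nia.
Qed.

(** * Running time *)

(** [P] and [C] are chosen before [D] and [r], so the bound can be specialized in two ways: to [n]
    and [#|H|] in general, and to the maximum degree plus 1 for closed neighborhoods. *)
Lemma vc_computed : exists P C, forall n (H : {set {set 'I_n}}) x D r,
  presents x H -> {in H, forall e : {set 'I_n}, #|e| <= D} ->
  (forall v, degree H v <= r) ->
  exists t, outputs_within P x t (vc H) /\
    t <= C * (#|H|.+1 * D.+1 ^ (vc H).+2 * (vc H).+1 * r.+1).
Proof.
exists (ccmd 0 vc_cmd), (size (ccmd 0 vc_cmd) * 50) => n H x D r.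
move=> [es [/allP uE pe ex]] leD dr.
have eqH : [seq [set v in e]%SET | e <- es] =i H.
  by move=> A; rewrite (perm_mem pe) mem_enum.
have szE : size es = #|H| by rewrite -(size_map (fun e => [set v in e]%SET)) (perm_size pe) cardE.
have leE : {in es, forall e, size e <= D}.
  move=> e ee; have := leD [set v in e]; rewrite -eqH map_f // cardsE.
  by rewrite (card_uniqP (uE e ee)); apply.
have dE v : count (fun e : seq 'I_n => v \in e) es <= r.
  apply: leq_trans (dr v); rewrite /degree cardE.
  rewrite (eq_count (a2 := preim (fun e => [set v in e]%SET) (fun A => v \in A))); last first.
    by move=> e /=; rewrite inE.
  rewrite -count_map (permP pe) -size_filter.
  apply: uniq_leq_size; first exact/filter_uniq/enum_uniq.
  by move=> A; rewrite mem_filter mem_enum => /andP[vA AH]; rewrite mem_enum inE AH.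
have [s [k [t [[le_k eA] out le_t]]]] :=
  @wp_compiled vc_cmd x _ isT (wp_vc eqH uE leE dE ex).
exists t; rewrite -eA; split=> //; rewrite eA -szE.
by apply: leq_trans le_t _; rewrite -mulnA leq_mul2l le_k orbT.
Qed.

(** * Exponents in terms of truncated logarithms *)

Lemma lt_trunc_log2 d : d < 2 ^ (trunc_log 2 d).+1.
Proof. exact: trunc_log_ltn. Qed.

Lemma vc_trunc_log (V : finType) (H : {set {set V}}) :
  vc H <= (trunc_log 2 (degeneracy H)).+1.
Proof.
have [->//|v0] := posnP (vc H).
by rewrite -ltnS -[vc H]prednK // ltnS ltnS trunc_log_max // vc_degeneracy.
Qed.

Lemma leq_expn_trunc_log n d : 1 < n -> d < n ^ (trunc_log 2 d).+1.
Proof.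
by move=> n1; apply: leq_trans (lt_trunc_log2 d) _; rewrite leq_exp2r.
Qed.

Lemma leq_self_expn n k : 1 < n -> k <= n ^ k.
Proof. by move=> n1; apply/ltnW/ltn_expl. Qed.

(** As [1 < n], every factor, constants included, is bounded by a power of [n]. *)
Lemma polynomial_bound n d v m C :
  1 < n -> v <= (trunc_log 2 d).+1 -> m <= n * d + 1 ->
  C * (m.+1 * n.+1 ^ v.+2 * v.+1 * m.+1) <= n ^ ((C + 12) * (trunc_log 2 d).+1).
Proof.
move=> n1; have := leq_expn_trunc_log d n1; move: (trunc_log 2 d) => L ltd lv lm.
have n0 : 0 < n by lia.
have hm : m.+1 <= n ^ L.+2 by rewrite expnS; nia.
have hn : n.+1 ^ v.+2 <= n ^ (2 * L.+3).
  rewrite expnM; apply: (@leq_trans ((n ^ 2) ^ v.+2)).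
    by rewrite leq_exp2r // -mulnn; nia.
  by rewrite leq_pexp2l // ?expn_gt0 ?n0 //; lia.
have hv : v.+1 <= n ^ L.+2.
  by apply: leq_trans (leq_self_expn _ n1).
(* The exponents sum to [C + 5 L + 12], at most [(C + 12) (L + 1)]. *)
apply: (@leq_trans (n ^ (C + (L.+2 + 2 * L.+3 + L.+2 + L.+2)))).
  rewrite !expnD; apply: leq_mul; first exact: leq_self_expn.
  exact: leq_mul (leq_mul (leq_mul hm hn) hv) hm.
by rewrite leq_pexp2l //; nia.
Qed.

(** Here [D] and [r] are both [d.+1]. The square arises from [d.+2 ^ v.+2], where the exponent and
    the logarithm of the base are both of order [log d]. *)
Lemma linear_bound n d v m C :
  0 < n -> 2 ^ v.-1 <= d.+1 -> m <= n ->
  C * (m.+1 * d.+2 ^ v.+2 * v.+1 * d.+2) <= n * 2 ^ ((C + 14) * (trunc_log 2 d).+1 ^ 2).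
Proof.
move=> n0; have := lt_trunc_log2 d; move: (trunc_log 2 d) => L ltd lv lm.
have lv' : v <= L.+2.
  have : 2 ^ v.-1 <= 2 ^ L.+1 by apply: leq_trans ltd.
  by rewrite leq_exp2l //; lia.
have hd : d.+2 <= 2 ^ L.+2 by rewrite expnS; lia.
have hD : d.+2 ^ v.+2 <= 2 ^ (L.+2 * L.+4).
  rewrite expnM; apply: (@leq_trans ((2 ^ L.+2) ^ v.+2)); first by rewrite leq_exp2r.
  by rewrite leq_pexp2l // expn_gt0.
have hv : v.+1 <= 2 ^ L.+3 by apply: leq_trans (leq_self_expn _ _).
have hm : m.+1 <= n * 2 ^ 1 by lia.
(* Besides the factor [n], the exponents of 2 sum to [C + L^2 + 8 L + 14]. *)
apply: (@leq_trans (2 ^ C * (n * 2 ^ 1 * 2 ^ (L.+2 * L.+4) * 2 ^ L.+3 * 2 ^ L.+2))).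
  apply: leq_mul; first exact: leq_self_expn.
  exact: leq_mul (leq_mul (leq_mul hm hD) hv) hd.
have -> : 2 ^ C * (n * 2 ^ 1 * 2 ^ (L.+2 * L.+4) * 2 ^ L.+3 * 2 ^ L.+2) =
    n * 2 ^ (C + 1 + L.+2 * L.+4 + L.+3 + L.+2).
  rewrite 4!expnD; move: (2 ^ C) (2 ^ 1) (2 ^ (_ * _)) (2 ^ _) (2 ^ _); nia.
rewrite leq_mul2l leq_pexp2l // ?orbT //.
by rewrite -mulnn; nia.
Qed.

(** By symmetry, [v] lies in the closed neighborhood of [x] exactly when [x] lies in that of [v],
    which leaves at most the maximum degree plus 1 choices of [x]. *)
Lemma closed_neighborhood_degree (V : finType) (adj : rel V) v :
  symmetric adj ->
  degree (closed_neighborhood_hypergraph adj) v <= (max_degree adj).+1.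
Proof.
move=> sa; apply: (@leq_trans #|[set x |: neighbors adj x | x in v |: neighbors adj v]|).
  apply/subset_leq_card/fintype.subsetP=> A; rewrite inE => /andP[/imsetP[x _ ->]].
  rewrite !inE => h; apply: imset_f; rewrite !inE.
  by rewrite sa eq_sym.
apply: leq_trans (leq_imset_card _ _) _; rewrite cardsU1.
by rewrite -add1n leq_add ?leq_b1 // /max_degree leq_bigmax.
Qed.

(* Real logarithms and asymptotic bounds *)
From mathcomp Require Import classical_sets reals topology normedtype landau exp.
Import Order.TTheory GRing.Theory Num.Theory.
Import numFieldNormedType.Exports.

Local Open Scope classical_set_scope.
Local Open Scope ring_scope.

Lemma trunc_log_log2 (R : realType) (d : nat) :
  (trunc_log 2 d)%:R <= log2 d%:R :> R.
Proof.
have ln2 : 0 < ln 2 :> R by rewrite ln_gt0 // ltr1n.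
(* At [d = 0] both sides are 0 by convention. *)
rewrite /log2; have [->|d0] := posnP d; first by rewrite trunc_log0 ln0 // mul0r.
rewrite ler_pdivlMr // mulr_natl -lnXn // -natrX.
by rewrite ler_ln ?posrE ?ltr0n ?expn_gt0 // ler_nat trunc_logP.
Qed.

Lemma log2_ge1 (R : realType) (d : nat) : (1 < d)%N -> 1 <= log2 d%:R :> R.
Proof.
move=> d1; apply: le_trans (trunc_log_log2 R d).
by rewrite (ler_nat _ 1) trunc_log_gt0.
Qed.

(** For [d >= 2] the logarithm is at least 1, so adding 1 to its integer part at most doubles it;
    hence the constant [c * 2 ^ k]. *)
Lemma trunc_log_bigO (R : realType) (c k : nat) :
  (fun d : nat => (c * (trunc_log 2 d).+1 ^ k)%:R : R) =O_\oo
  (fun d : nat => log2 d%:R ^+ k).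
Proof.
apply/eqOP; exists (c * 2 ^ k)%:R; split=> // y ly; exists 2%N => // d /= d2.
have l1 := log2_ge1 R d2.
have l0 : 0 <= log2 d%:R ^+ k :> R by rewrite exprn_ge0 // (le_trans ler01).
rewrite !ger0_norm ?ler0n //; apply: le_trans (ler_wpM2r l0 (ltW ly)).
rewrite !natrM !natrX -mulrA -exprMn ler_wpM2l //.
rewrite lerXn2r ?nnegrE ?ler0n //; first by rewrite mulr_ge0 // (le_trans ler01).
by rewrite -natr1 mulr_natl mulr2n lerD // trunc_log_log2.
Qed.

Theorem theorem3p1 (R : realType) :
  (forall (V : finType) (H : {set {set V}}),
     (vc H)%:R <= log2 (degeneracy H)%:R + 1 :> R)
  /\
  (exists (P : program) (f : nat -> R),
     f =O_\oo (fun d : nat => log2 d%:R) /\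
     forall (n : nat) (H : {set {set 'I_n}}) (x : seq nat),
       presents x H ->
       exists t : nat,
         outputs_within P x t (vc H) /\
         ((1 < n)%N -> t%:R <= n%:R `^ f (degeneracy H)))
  /\
  (exists (P : program) (f : nat -> R),
     f =O_\oo (fun d : nat => log2 d%:R ^+ 2) /\
     forall (n : nat) (adj : rel 'I_n) (x : seq nat),
       symmetric adj -> irreflexive adj ->
       presents x (closed_neighborhood_hypergraph adj) ->
       exists t : nat,
         outputs_within P x t (vc (closed_neighborhood_hypergraph adj)) /\
         ((0 < n)%N -> t%:R <= n%:R * 2 `^ f (max_degree adj))).
Proof.
have [P [C comp]] := vc_computed.
split=> [V H|].
  apply: le_trans (_ : (trunc_log 2 (degeneracy H)).+1%:R <= _).
    by rewrite ler_nat vc_trunc_log.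
  by rewrite -natr1 lerD2r trunc_log_log2.
split.
  (* The exponent takes natural values, which reduces the real power to a natural one. *)
  exists P, (fun d => ((C + 12) * (trunc_log 2 d).+1 ^ 1)%:R).
  split; first exact: (trunc_log_bigO R (C + 12) 1).
  move=> n H x pr.
  have leD : {in H, forall e : {set 'I_n}, (#|e| <= n)%N}.
    by move=> e _; rewrite -[leqRHS]card_ord max_card.
  have dr v : (degree H v <= #|H|)%N.
    by apply/subset_leq_card/fintype.subsetP=> e; rewrite inE => /andP[].
  have [t [out le_t]] := comp n H x n #|H| pr leD dr.
  exists t; split=> // n1; rewrite powR_mulrn // -natrX ler_nat expn1.
  apply: leq_trans le_t _; apply: polynomial_bound => //; first exact: vc_trunc_log.
  by rewrite -[X in (X * _ + _)%N](card_ord n) card_edges.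
exists P, (fun d => ((C + 14) * (trunc_log 2 d).+1 ^ 2)%:R).
split; first exact: trunc_log_bigO.
move=> n adj x sa _ pr; set H := closed_neighborhood_hypergraph adj.
have dr v : (degree H v <= (max_degree adj).+1)%N by apply: closed_neighborhood_degree.
have leD : {in H, forall e : {set 'I_n}, (#|e| <= (max_degree adj).+1)%N}.
  move=> _ /imsetP[y _ ->]; rewrite cardsU1 -add1n leq_add ?leq_b1 //.
  by rewrite /max_degree leq_bigmax.
have [t [out le_t]] := comp n H x _ _ pr leD dr.
exists t; split=> // n0; rewrite powR_mulrn // -natrX -natrM ler_nat.
apply: leq_trans le_t _; apply: linear_bound => //.
  (* A shattered set is bounded directly by the vertex degrees, so the maximum degree takes the
     place of the degeneracy. *)
  have [-> //|v0] := posnP (vc H); exact: vc_degree dr v0.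
by rewrite -[leqRHS](card_ord n) leq_imset_card.
Qed.
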